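(* Let $0<\alpha\le 2$ with $\alpha\neq 1$, and distinguish the cases (a) $0<\alpha<1$ and (b) $1<\alpha\le 2$. Let $\mu$ be a real number satisfying $$0<\mu\le \cos(\alpha\pi/2)\ \text{ in case (a)},\qquad 0<\mu\le \frac{|\cos(\alpha\pi/2)|}{\alpha}\ \text{ in case (b)}.$$ Define $(p_k)_{k\in\mathbb{Z}}$ in case (a) by $$p_0=1-\frac{\mu}{\cos(\alpha\pi/2)},\qquad p_k=(-1)^{|k|+1}\frac{\mu}{2\cos(\alpha\pi/2)}\binom{\alpha}{|k|}\quad (k\neq 0),$$ and in case (b) by $$p_0=1+\frac{\mu}{\cos(\alpha\pi/2)}\binom{\alpha}{1},\qquad p_{\pm1}=-\frac{\mu}{2\cos(\alpha\pi/2)}\left[1+\binom{\alpha}{2}\right],$$ $$p_{\pm k}=(-1)^k\frac{\mu}{2\cos(\alpha\pi/2)}\binom{\alpha}{k+1}\quad (k=2,3,\dots).$$ Let $Y_1,Y_2,\dots$ be independent identically distributed $\mathbb{Z}$-valued random variables with $P(Y_m=k)=p_k$ for all $k\in\mathbb{Z}$. Fix $t>0$. For each $n\in\mathbb{N}$ put $\tau=t/n$, let $h=h_n>0$ be determined by the scaling relation $\tau=\mu h^\alpha$, and let $$S_n=h_n\sum_{m=1}^n Y_m .$$ Then, as $n\to\infty$, $S_n$ converges in distribution to the random variable $S(t)$ whose probability density is $g_\alpha(\cdot,t;0)$.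
   Context: For $0<\alpha\le 2$ and $t>0$, $g_\alpha(x,t;0)=\frac{1}{2\pi}\int_{-\infty}^{+\infty}e^{-i\kappa x}\exp(-t|\kappa|^\alpha)\,d\kappa$ ($x\in\mathbb{R}$) is the symmetric stable probability density with characteristic function $\int_{-\infty}^{+\infty}e^{i\kappa x}g_\alpha(x,t;0)\,dx=\exp(-t|\kappa|^\alpha)$, $\kappa\in\mathbb{R}$. $S(t)$ denotes a random variable with this density. For real $\alpha$ and integer $k\ge 0$, $\binom{\alpha}{k}=\alpha(\alpha-1)\cdots(\alpha-k+1)/k!$ is the generalized binomial coefficient. *)

(* Defs.v *)
From HB Require Import structures.
From mathcomp Require Import all_boot all_order all_algebra.
From mathcomp Require Import finmap complex.
From mathcomp Require Import all_classical all_reals all_analysis.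
From mathcomp Require Import measurable_realfun.

Set Implicit Arguments.
Unset Strict Implicit.
Unset Printing Implicit Defensive.

Import Order.TTheory GRing.Theory Num.Theory.
Import numFieldNormedType.Exports.

Local Open Scope classical_set_scope.
Local Open Scope ring_scope.

(* As for [nat] in MathComp-Analysis: every set of integers is measurable. *)
HB.instance Definition _ := isPointed.Build int 0.
HB.instance Definition _ := @isMeasurable.Build default_measure_display
  int discrete_measurable discrete_measurable0
  discrete_measurableC discrete_measurableU.

Definition gbinom {R : realType} (a : R) (k : nat) : R :=
  (\prod_(i < k) (a - i%:R)) / k`!%:R.

Definition step_prob_lt1 {R : realType} (alpha mu : R) (k : int) : R :=
  if k == 0 then 1 - mu / cos (alpha * pi / 2)
  else (-1) ^+ (`|k|%N + 1) * (mu / (2 * cos (alpha * pi / 2)))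
       * gbinom alpha `|k|.

Definition step_prob_gt1 {R : realType} (alpha mu : R) (k : int) : R :=
  if k == 0 then 1 + mu / cos (alpha * pi / 2) * gbinom alpha 1
  else if `|k|%N == 1%N then
    - (mu / (2 * cos (alpha * pi / 2))) * (1 + gbinom alpha 2)
  else (-1) ^+ `|k| * (mu / (2 * cos (alpha * pi / 2)))
       * gbinom alpha (`|k|%N + 1).

Definition step_prob {R : realType} (alpha mu : R) : int -> R :=
  if alpha < 1 then step_prob_lt1 alpha mu else step_prob_gt1 alpha mu.

Definition mutually_independent d d' (T : measurableType d)
    (T' : measurableType d') (R : realType) (P : probability T R)
    (I : choiceType) (X : I -> {RV P >-> T'}) : Prop :=
  forall (J : {fset I}) (A : I -> set T'), (forall i, measurable (A i)) ->
    P (\bigcap_(i in [set` J]) (X i @^-1` A i)) =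
    (\prod_(i <- J) P (X i @^-1` A i))%E.

Definition has_density d (T : measurableType d) (R : realType)
    (P : probability T R) (X : {RV P >-> R}) (f : R -> R) : Prop :=
  [/\ measurable_fun [set: R] f, forall x, 0 <= f x &
      forall A : set R, measurable A ->
        distribution P X A = (\int[lebesgue_measure]_(x in A) (f x)%:E)%E].

(* The limit variable may live on a different probability space. *)
Definition cvg_in_distribution d d' (T : measurableType d)
    (T' : measurableType d') (R : realType) (P : probability T R)
    (Q : probability T' R) (X_ : nat -> {RV P >-> R}) (X : {RV Q >-> R}) : Prop :=
  forall x : R, {for x, continuous (cdf X)} ->
    cdf (X_ n) x @[n --> \oo] --> cdf X x.

Section stable_density.
Context {R : realType}.
Local Open Scope complex_scope.

Definition expi (y : R) : R[i] := cos y +i* sin y.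

Definition cintegral (f : R -> R[i]) : R[i] :=
  (\int[lebesgue_measure]_k complex.Re (f k)) +i*
  (\int[lebesgue_measure]_k complex.Im (f k)).

Definition stable_fourier (alpha t x : R) : R[i] :=
  ((2 * pi)^-1)%:C *
  cintegral (fun k => expi (- (k * x)) * (expR (- t * `|k| `^ alpha))%:C).

(* [stable_fourierE] below: taking the real part discards nothing. *)
Definition stable_density (alpha t x : R) : R :=
  complex.Re (stable_fourier alpha t x).

Lemma Rintegral_odd (f : R -> R) : measurable_fun [set: R] f ->
  (forall x, f (- x) = - f x) -> \int[lebesgue_measure]_x f x = 0.
Proof.
move=> mf oddf; rewrite /Rintegral integralE.
have mg : measurable_fun [set: R] ((EFin \o f)^\+)%E.
  exact/measurable_funepos/measurable_EFinP.
suff -> : (\int[lebesgue_measure]_x ((EFin \o f)^\- x) =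
           \int[lebesgue_measure]_x ((EFin \o f)^\+ x))%E.
  by case: (\int[lebesgue_measure]_x ((EFin \o f)^\+ x))%E => [r| |] //=;
    rewrite subrr.
transitivity (\int[pushforward lebesgue_measure
    (-%R : _ -> measurableTypeR R)]_x ((EFin \o f)^\+ x))%E; last first.
  by apply: eq_measure_integral => //= A mA _; exact: lebesgue_measureN.
rewrite ge0_integral_pushforward//= preimage_setT.
by apply: eq_integral => x _; rewrite funenegE funeposE /= oddf.
Qed.

Lemma stable_fourierE (alpha t x : R) :
  stable_fourier alpha t x = (stable_density alpha t x)%:C.
Proof.
suff im0 : complex.Im (stable_fourier alpha t x) = 0.
  by rewrite /stable_density; move: im0; case: stable_fourier => a b /= ->.
rewrite /= mul0r addr0 Rintegral_odd ?mulr0// => [|k]; last first.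
  by rewrite !mulr0 !add0r normrN (mulNr k) !sinN !mulNr.
rewrite (_ : (fun _ => _) = (fun k : R => sin (- (k * x))) \*
    (fun k : R => expR (- t * `|k| `^ alpha))); last first.
  by apply/funext => k /=; rewrite mulr0 add0r.
apply: measurable_funM.
  apply: measurableT_comp.
    by apply: continuous_measurable_fun; exact: continuous_sin.
  by apply: measurableT_comp => //; apply: measurable_funM.
apply: measurableT_comp; first exact: measurable_expR.
apply: measurable_funM => //.
apply: (measurableT_comp (measurable_powR alpha)).
exact: normr_measurable.
Qed.

End stable_density.

Section scaled_walk.
Context d (T : measurableType d) (R : realType) (P : probability T R).
Variables (h : R^nat) (Y : nat -> {RV P >-> int}) (n : nat).

(* [Y m] is the variable of index m + 1, so the sum has the first n steps. *)
Definition scaled_walk (w : T) : R := h n * \sum_(m < n) (Y m w)%:~R.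

Lemma measurable_scaled_walk : measurable_fun [set: T] scaled_walk.
Proof.
apply: measurable_funM => //; apply: measurable_sum => m.
exact: (@measurableT_comp _ _ _ _ _ _ (intr : int -> R)).
Qed.

HB.instance Definition _ :=
  isMeasurableFun.Build _ _ _ _ scaled_walk measurable_scaled_walk.

End scaled_walk.

(* Main.v *)
Require Import Defs.
From HB Require Import structures.
From mathcomp Require Import all_boot all_order all_algebra.
From mathcomp Require Import ring lra.
From mathcomp Require Import finmap.
From mathcomp Require Import all_classical all_reals all_analysis.
From mathcomp Require Import measurable_realfun.

Set Implicit Arguments.
Unset Strict Implicit.
Unset Printing Implicit Defensive.

Import Order.TTheory GRing.Theory Num.Theory.
Import numFieldNormedType.Exports.

(* A local limit theorem replaces Levy's continuity theorem.  On the unit circle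
   the binomial series gives the characteristic function of a step in closed form,
     phi x = 1 - mu / cos (alpha pi / 2) * (2 sin (x / 2))^alpha
                 * cos (e x + alpha (pi - x) / 2)        (0 < x <= pi),
   with e = 0 or 1 in case (a) or (b), so that 1 - phi x ~ mu x^alpha at 0 and
   |phi x| <= exp (- c x^alpha).  Fourier inversion on the lattice writes
   P(Y_1 + ... + Y_n = j) / h as an integral of cos (j h x) phi (h x)^n over
   ]0, pi / h], which tends to the stable density at y when j h tends to y, by
   dominated convergence.  Spreading each atom of S_n over the adjacent lattice
   cell, to its right or to its left, turns this into pointwise convergence of
   densities, and Fatou's lemma on ]-oo, x] and on ]x, +oo[ bounds the limits of
   the distribution functions from both sides.  The only periodic case,
   alpha = 2 and mu = 1/2 (simple random walk), is covered by working on a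
   sublattice of step s = 2. *)

(** Two difficulties shape the argument. The binomial series must be summed on the unit circle
    itself. Dividing its partial sum by (1 - z)^alpha makes the radial derivative collapse to a
    single term, so the remainder is at most a constant, depending on x, times the next coefficient.
    That coefficient tends to 0 because, up to a factor, it is one of the p_k, which have a
    convergent sum. Fatou's lemma, on the other hand, only gives lower bounds. It is applied to a
    half-line and to its complement, and total mass one of the limit law, known because S has the
    density, turns the second bound into an upper one. The direction of spreading is chosen so that
    a point of the half-line receives mass only from an atom of the same half-line; no cell
    straddling x has to be estimated. The exponential bound on phi combines the asymptotics at 0
    with a bound of |phi| away from 1 elsewhere. The latter follows from p_1 > 0 together with
    either p_0 + p_2 > 0 or a shorter range of x. *)

Local Open Scope classical_set_scope.
Local Open Scope ring_scope.

(** * The binomial series on the unit circle *)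

Section binomial_circle.
Context {R : realType}.
Implicit Types (a b psi x r : R).

Lemma is_derive1_const (c x : R) : is_derive x 1 (fun=> c) (0 : R).
Proof. exact: is_derive_cst. Qed.

Lemma is_derive1D (f g : R -> R) x df dg : is_derive x 1 f df -> is_derive x 1 g dg ->
  is_derive x 1 (fun y => f y + g y) (df + dg).
Proof. exact: is_deriveD. Qed.

Lemma is_derive1N (f : R -> R) x df : is_derive x 1 f df ->
  is_derive x 1 (fun y => - f y) (- df).
Proof. exact: is_deriveN. Qed.

Lemma is_derive1M (f g : R -> R) x df dg : is_derive x 1 f df -> is_derive x 1 g dg ->
  is_derive x 1 (fun y => f y * g y) (df * g x + f x * dg).
Proof.
move=> Hf Hg; have := is_deriveM Hf Hg.
by rewrite /GRing.scale /= addrC (mulrC (g x)).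
Qed.

Lemma is_derive1X n x : is_derive x 1 (fun y : R => y ^+ n) (n%:R * x ^+ n.-1).
Proof.
have := is_deriveX n (is_derive_id x (1 : R)).
rewrite /GRing.scale /= mulr1.
by rewrite exprfctE.
Qed.

Lemma is_derive1_fun (f g : R -> R) x df dg : is_derive (g x) 1 f df ->
  is_derive x 1 g dg -> is_derive x 1 (fun y => f (g y)) (df * dg).
Proof.
by move=> Hf Hg; have := is_derive1_comp Hf Hg.
Qed.

Lemma gbinomS a k : k.+1%:R * gbinom a k.+1 = (a - k%:R) * gbinom a k.
Proof.
rewrite /gbinom big_ord_recr /= factS natrM invfM mulrACA.
have k0 : k.+1%:R != 0 :> R by rewrite pnatr_eq0.
have f0 : k`!%:R != 0 :> R by rewrite pnatr_eq0 -lt0n fact_gt0.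
by field; rewrite f0 addrC natr1 k0.
Qed.

(** Both signs of w are compared with K r^(N+1) / (N+1), whose derivative is the majorant. The gain
    1 / (N+1) later cancels the factor N+1 in the derivative of the partial binomial sums. *)
Lemma le_increment_power (w dw : R -> R) K N :
  (forall r, 0 <= r <= 1 -> is_derive r 1 w (dw r)) ->
  (forall r, 0 <= r <= 1 -> `|dw r| <= K * r ^+ N) ->
  `|w 1 - w 0| <= K / N.+1%:R.
Proof.
move=> dwP dwK.
have main (v dv : R -> R) : (forall r, 0 <= r <= 1 -> is_derive r 1 v (dv r)) ->
    (forall r, 0 <= r <= 1 -> `|dv r| <= K * r ^+ N) ->
    v 1 - v 0 <= K / N.+1%:R.
  move=> dvP dvK.
  pose q r := K / N.+1%:R * r ^+ N.+1 - v r.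
  have dq (r : R) : 0 <= r <= 1 -> is_derive r 1 q (K * r ^+ N - dv r).
    move=> /dvP dvr.
    apply: (is_derive_eq (is_derive1D (is_derive1M (is_derive1_const (K / N.+1%:R) r)
      (is_derive1X N.+1 r)) (is_derive1N dvr))).
    rewrite mul0r add0r /=.
    have N0 : N.+1%:R != 0 :> R by rewrite pnatr_eq0.
    by field; rewrite addrC natr1 N0.
  have : q 0 <= q 1.
    apply: (@ger0_derive1_ndecr R q 0 1) => //.
    - by move=> r; rewrite in_itv/= => /andP[r0 r1]; have := dq r; case=> //; rewrite !ltW.
    - move=> r; rewrite in_itv/= => /andP[r0 r1]; rewrite derive1E.
      have r01 : 0 <= r <= 1 by rewrite !ltW.
      have [_ ->] := dq r r01.
      by rewrite subr_ge0 (le_trans (ler_norm _))// dvK.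
    - apply: derivable_within_continuous => r; rewrite in_itv/= => r01.
      by have [] := dq r r01.
  by rewrite /q expr0n/= expr1n mulr0 mulr1 sub0r lerBrDr addrC.
rewrite ler_norml main// andbT lerNl opprB.
have -> : w 0 - w 1 = (- w) 1 - (- w) 0 by rewrite !opprfctE opprK addrC.
apply: (main _ (- dw)) => r r01; last by rewrite opprfctE normrN dwK.
by have := dwP r r01; exact: is_deriveN.
Qed.

(* [1 - r e^(ix) = exp (logmod x r - i marg x r)], and [cos_power x b psi r] is
   the real part of [e^(i psi) (1 - r e^(ix))^(-b)]. *)
Definition logmod x r := ln ((1 - r * cos x) ^+ 2 + (r * sin x) ^+ 2) / 2.

Definition marg x r := atan (r * sin x / (1 - r * cos x)).

Definition cos_power x b psi r := expR (- b * logmod x r) * cos (psi + b * marg x r).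

Lemma logmod_cos x r : 0 < 1 - r * cos x ->
  expR (logmod x r) * cos (marg x r) = 1 - r * cos x.
Proof.
set u := 1 - _ => u0; set v := r * sin x.
have c0 : 0 < cos (marg x r) by rewrite cos_gt0_pihalf// atan_gtNpi2 atan_ltpi2.
have q0 : 0 < u ^+ 2 + v ^+ 2 by rewrite ltr_pwDl ?sqr_ge0// exprn_gt0.
apply/eqP; rewrite -(@eqrXn2 _ 2)//; last 2 first.
- by rewrite mulr_ge0 ?expR_ge0// ltW.
- exact: ltW.
have -> : (expR (logmod x r) * cos (marg x r)) ^+ 2 =
    (u ^+ 2 + v ^+ 2) * cos (marg x r) ^+ 2.
  by rewrite exprMn -expRM_natl /logmod [2%:R * _]mulrC divfK// lnK.
have := cos2_tan2 (lt0r_neq0 c0); rewrite atanK -/u -/v => E.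
have c20 : cos (marg x r) != 0 by rewrite gt_eqF.
have -> : cos (marg x r) ^+ 2 = (1 + (v / u) ^+ 2)^-1 by rewrite -E invrK.
apply/eqP; field; rewrite (gt_eqF u0)/=.
by rewrite gt_eqF.
Qed.

Lemma logmod_sin x r : 0 < 1 - r * cos x ->
  expR (logmod x r) * sin (marg x r) = r * sin x.
Proof.
move=> u0.
have c0 : 0 < cos (marg x r) by rewrite cos_gt0_pihalf// atan_gtNpi2 atan_ltpi2.
have := atanK (r * sin x / (1 - r * cos x)); rewrite -/(marg x r) /tan.
move=> /(canRL (divfK (lt0r_neq0 c0))) ->.
by rewrite mulrCA logmod_cos// divfK// gt_eqF.
Qed.

Lemma cosD_marg x r : 0 < 1 - r * cos x ->
  expR (logmod x r) * cos (x + marg x r) = cos x - r.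
Proof.
move=> u0; rewrite cosD mulrBr !mulrA ![_ * cos x]mulrC ![_ * sin x]mulrC -!mulrA.
rewrite logmod_cos// logmod_sin//; have := cos2Dsin2 x => /(canRL (addrK _)) h.
by transitivity (cos x - r * (cos x ^+ 2 + sin x ^+ 2)); [ring|rewrite cos2Dsin2 mulr1].
Qed.

Lemma sinD_marg x r : 0 < 1 - r * cos x ->
  expR (logmod x r) * sin (x + marg x r) = sin x.
Proof.
move=> u0; rewrite sinD mulrDr !mulrA ![_ * cos x]mulrC ![_ * sin x]mulrC -!mulrA.
rewrite logmod_cos// logmod_sin//; ring.
Qed.

Lemma sqr_modE x r : 0 < 1 - r * cos x ->
  expR (logmod x r) ^+ 2 = (1 - r * cos x) ^+ 2 + (r * sin x) ^+ 2.
Proof.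
move=> u0; rewrite -logmod_cos// -logmod_sin// !exprMn -mulrDr cos2Dsin2.
by rewrite mulr1.
Qed.

Lemma is_derive_logmod x r : 0 < 1 - r * cos x ->
  is_derive r 1 (logmod x) (- (expR (- logmod x r) * cos (x + marg x r))).
Proof.
move=> u0.
have q0 : 0 < (1 - r * cos x) ^+ 2 + (r * sin x) ^+ 2.
  by rewrite ltr_pwDl ?sqr_ge0// exprn_gt0.
have dq : is_derive r 1 (fun r => (1 - r * cos x) ^+ 2 + (r * sin x) ^+ 2)
    (2%:R * (1 - r * cos x) ^+ 1 * (0 + - (1 * cos x + r * 0)) +
     2%:R * (r * sin x) ^+ 1 * (1 * sin x + r * 0)).
  exact: (is_derive1D (is_derive1_fun (is_derive1X 2 _)
      (is_derive1D (is_derive1_const 1 r)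
        (is_derive1N (is_derive1M (is_derive_id r 1) (is_derive1_const (cos x) r)))))
    (is_derive1_fun (is_derive1X 2 _)
      (is_derive1M (is_derive_id r 1) (is_derive1_const (sin x) r)))).
apply: (is_derive_eq (is_derive1M
  (@is_derive1_fun (@ln R) _ r _ _ (is_derive1_ln q0) dq) (is_derive1_const 2^-1 r))).
rewrite expRN; have := cosD_marg u0 => /(canRL (mulKf _)) ->; last by rewrite expR_eq0.
rewrite -sqr_modE//.
have h := cos2Dsin2 x.
have E0 : expR (logmod x r) != 0 by rewrite expR_eq0.
transitivity (expR (logmod x r) ^- 2 * (r * (cos x ^+ 2 + sin x ^+ 2) - cos x)).
  by field; exact: E0.
by rewrite h; field; exact: E0.
Qed.

Lemma is_derive_marg x r : 0 < 1 - r * cos x ->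
  is_derive r 1 (marg x) (expR (- logmod x r) * sin (x + marg x r)).
Proof.
move=> u0.
have q0 : 0 < (1 - r * cos x) ^+ 2 + (r * sin x) ^+ 2.
  by rewrite ltr_pwDl ?sqr_ge0// exprn_gt0.
have u00 : 1 - r * cos x != 0 by rewrite gt_eqF.
have dV : is_derive r 1 (fun r => (1 - r * cos x)^-1)
    (- (1 - r * cos x) ^- 2 *: (0 - (1 * cos x + r * 0))).
  apply: is_deriveV => //.
  exact: (is_derive1D (is_derive1_const 1 r)
    (is_derive1N (is_derive1M (is_derive_id r 1) (is_derive1_const (cos x) r)))).
have dq : is_derive r 1 (fun r => r * sin x / (1 - r * cos x))
    ((1 * sin x + r * 0) / (1 - r * cos x) +
     r * sin x * (- (1 - r * cos x) ^- 2 *: (0 - (1 * cos x + r * 0)))).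
  exact: (is_derive1M (is_derive1M (is_derive_id r 1) (is_derive1_const (sin x) r)) dV).
apply: (is_derive_eq (@is_derive1_fun (@atan R) _ r _ _ (is_derive1_atan _) dq)).
rewrite expRN; have := sinD_marg u0 => /(canRL (mulKf _)) ->; last by rewrite expR_eq0.
rewrite /GRing.scale /=.
rewrite [RHS]mulrA -invfM -expr2 sqr_modE//.
by field; rewrite (gt_eqF q0) u00.
Qed.

(** Real part of d/dr (1 - z)^(-b) = b e^(ix) (1 - z)^(-b-1) with z = r e^(ix); the factor e^(ix)
    becomes the shift of [psi] by x. *)
Lemma is_derive_cos_power x b psi r : 0 < 1 - r * cos x ->
  is_derive r 1 (cos_power x b psi) (b * cos_power x (b + 1) (psi + x) r).
Proof.
move=> u0; have dl := is_derive_logmod u0; have dm := is_derive_marg u0.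
apply: (is_derive_eq (is_derive1M
  (is_derive1_fun (is_derive_expR _) (is_derive1M (is_derive1_const (- b) r) dl))
  (is_derive1_fun (is_derive_cos _) (is_derive1D (is_derive1_const psi r)
    (is_derive1M (is_derive1_const b r) dm))))).
rewrite /cos_power.
rewrite (_ : - (b + 1) * _ = - b * logmod x r + - logmod x r); last by ring.
rewrite expRD.
rewrite (_ : psi + x + _ = (psi + b * marg x r) + (x + marg x r)); last by ring.
rewrite [cos (_ + (x + _))]cosD; ring.
Qed.

(** Real part of (1 - z)^(-b) = (1 - z) (1 - z)^(-b-1). It brings all terms to the exponent b + 1,
    where the derivative of the partial sums telescopes. *)
Lemma cos_power_split x b psi r : 0 < 1 - r * cos x ->
  cos_power x b psi r = cos_power x (b + 1) psi r - r * cos_power x (b + 1) (psi + x) r.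
Proof.
move=> u0; rewrite /cos_power.
have -> : expR (- b * logmod x r) = expR (- (b + 1) * logmod x r) * expR (logmod x r).
  by rewrite -expRD; congr expR; ring.
rewrite (_ : psi + x + _ = (psi + (b + 1) * marg x r) + x); last by ring.
rewrite (_ : psi + b * _ = (psi + (b + 1) * marg x r) - marg x r); last by ring.
set t := psi + (b + 1) * _.
rewrite cosB cosD.
have := logmod_cos u0; have := logmod_sin u0.
set e := expR (logmod x r); set E := expR _ => h1 h2.
transitivity (E * (cos t * (e * cos (marg x r)) + sin t * (e * sin (marg x r)))).
  by ring.
rewrite h1 h2; ring.
Qed.

Let c a k : R := (-1) ^+ k * gbinom a k.

Let cS a k : k.+1%:R * c a k.+1 = - ((a - k%:R) * c a k).
Proof. by rewrite /c exprS mulrCA gbinomS; ring. Qed.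

Let W x a psi N r :=
  \sum_(0 <= k < N.+1) c a k * r ^+ k * cos_power x a (psi + k%:R * x) r.

(* [W x a psi N r] is a partial sum of the binomial series of [(1 - z)^a] at
   [z = r e^(ix)], divided by [(1 - z)^a]; its derivative in [r] telescopes. *)
Lemma is_derive_partial_binomial x a psi N r : 0 < 1 - r * cos x ->
  is_derive r 1 (W x a psi N)
    (- (N.+1%:R * c a N.+1 * r ^+ N * cos_power x (a + 1) (psi + N.+1%:R * x) r)).
Proof.
move=> u0.
have dT k : is_derive r 1 (fun r => c a k * r ^+ k * cos_power x a (psi + k%:R * x) r)
    ((0 * r ^+ k + c a k * (k%:R * r ^+ k.-1)) * cos_power x a (psi + k%:R * x) r +
     c a k * r ^+ k * (a * cos_power x (a + 1) (psi + k%:R * x + x) r)).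
  exact: (is_derive1M (is_derive1M (is_derive1_const (c a k) r) (is_derive1X k r))
    (is_derive_cos_power _ _ u0)).
elim: N => [|N IH].
  rewrite (_ : W x a psi 0%N = fun r => c a 0 * r ^+ 0 * cos_power x a (psi + 0%:R * x) r);
    last by apply/funext => y; rewrite /W big_nat1.
  apply: (is_derive_eq (dT 0%N)).
  have := cS a 0; rewrite mul1r subr0 => ->.
  by rewrite !mul0r !addr0 !mul1r !expr0; ring.
rewrite (_ : W x a psi N.+1 = fun r => W x a psi N r +
    c a N.+1 * r ^+ N.+1 * cos_power x a (psi + N.+1%:R * x) r);
  last by apply/funext => y; rewrite /W big_nat_recr.
apply: (is_derive_eq (is_derive1D IH (dT N.+1))).
rewrite (cos_power_split a _ u0) [N.+2%:R * _]cS /=.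
rewrite (_ : psi + N.+1%:R * x + x = psi + N.+2%:R * x); last first.
  by rewrite -[N.+2%:R]natr1; ring.
by rewrite exprS; ring.
Qed.

Lemma cos_lt1 x : 0 < x <= pi -> cos x < 1.
Proof.
move=> /andP[x0 xpi]; rewrite -[ltRHS](@cos0 R) ltr_cos// in_itv/= ?lexx ?pi_ge0//.
by rewrite xpi ltW.
Qed.

(** At r = 0 the quotient equals cos psi for every N, and its increment up to r = 1 is at most C
    |gbinom a (N+1)|. Since x > 0, the segment from 0 to e^(ix) avoids the singularity 1. *)
Lemma partial_binomial_cvg x a psi : 0 < x <= pi -> gbinom a @ \oo --> 0 ->
  W x a psi ^~ 1 @ \oo --> cos psi.
Proof.
move=> xpi a0.
have u0 r : 0 <= r <= 1 -> 0 < 1 - r * cos x.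
  move=> /andP[r0 r1]; rewrite subr_gt0; have [c0|c0] := leP (cos x) 0.
    by rewrite (le_lt_trans _ ltr01)// mulr_ge0_le0.
  by rewrite (le_lt_trans _ (cos_lt1 xpi))// ler_piMl// ltW.
(* Only the modulus is maximized over [0, 1], so [C] depends neither on the phase nor on N. *)
have [C C0 cos_powerC] : exists2 C : R, 0 <= C & forall b r, 0 <= r <= 1 ->
    `|cos_power x (a + 1) b r| <= C.
  have [||s _ sP] := @EVT_max R (fun r => expR (- (a + 1) * logmod x r)) 0 1 => //.
    apply: derivable_within_continuous => r; rewrite in_itv/= => r01.
    have [+ _] := is_derive1_fun (is_derive_expR _)
      (is_derive1M (is_derive1_const (- (a + 1)) r) (is_derive_logmod (u0 r r01))).
    exact.
  exists (expR (- (a + 1) * logmod x s)); first exact: expR_ge0.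
  move=> b r r01; rewrite normrM ger0_norm ?expR_ge0// -[leRHS]mulr1.
  by rewrite ler_pM ?expR_ge0// ?cos_max// sP// in_itv.
have W0 N : W x a psi N 0 = cos psi.
  rewrite /W big_nat_recl// big1 => [|k _]; last by rewrite exprS mul0r mulr0 mul0r.
  rewrite /c /cos_power /logmod /marg /gbinom big_ord0 !mul0r subr0 expr1n.
  rewrite (expr0n _ 2)/= !addr0.
  by rewrite ln1 mul0r atan0 !mulr0 expR0 !addr0 !expr0 fact0 invr1 !mul1r.
have main N : `|W x a psi N 1 - cos psi| <= C * `|gbinom a N.+1|.
  have := @le_increment_power (W x a psi N)
    (fun r => - (N.+1%:R * c a N.+1 * r ^+ N * cos_power x (a + 1) (psi + N.+1%:R * x) r))
    (N.+1%:R * `|c a N.+1| * C) N.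
  rewrite W0 => H; apply: (le_trans (H _ _)).
  - by move=> r /u0; exact: is_derive_partial_binomial.
  - move=> r r01; rewrite normrN 3!normrM (normrX _ r) normr_nat.
    have /andP[r0 _] := r01; rewrite (ger0_norm r0) -!mulrA !ler_wpM2l//.
    by rewrite mulrC ler_wpM2r ?exprn_ge0// cos_powerC.
  - have N0 : N.+1%:R != 0 :> R by rewrite pnatr_eq0.
    rewrite (_ : _ / _ = C * `|c a N.+1|); last by field; rewrite addrC natr1.
    by rewrite /c normrM normrX normrN1 expr1n mul1r.
apply/cvgrPdist_le => e e0.
have : (fun N => C * `|gbinom a N.+1|) @ \oo --> 0.
  rewrite -(mulr0 C) -(@normr0 _ R); apply: cvgMr; apply: cvg_norm.
  by rewrite (cvg_shiftS (gbinom a)).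
move=> /cvgrPdist_le/(_ e e0); apply: filterS => N.
rewrite sub0r normrN ger0_norm ?mulr_ge0// distrC.
exact: le_trans.
Qed.

Lemma binomial_circle a x psi : 0 < x <= pi -> gbinom a @ \oo --> 0 ->
  (fun N => \sum_(0 <= k < N.+1) (-1) ^+ k * gbinom a k * cos (psi + k%:R * x)) @ \oo
    --> (2 * sin (x / 2)) `^ a * cos (psi - a * ((pi - x) / 2)).
Proof.
move=> /[dup] xpi /andP[x0 xlepi] a0.
have c1 := cos_lt1 xpi.
have s0 : 0 < sin (x / 2).
  have pi0 := @pi_gt0 R; rewrite sin_gt0_pi//; lra.
have xE : x = (x / 2) *+ 2 by rewrite -mulr_natr divfK.
have cosE : 1 - cos x = sin (x / 2) ^+ 2 *+ 2.
  by rewrite {1}xE cos_mulr2n cos2sin2; ring.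
have sinE : sin x = (cos (x / 2) * sin (x / 2)) *+ 2 by rewrite {1}xE sin_mulr2n.
(* On the circle 1 - e^(ix) = 2 sin (x / 2) e^(- i (pi - x) / 2). *)
have -> : (pi - x) / 2 = marg x 1.
  rewrite /marg !mul1r cosE sinE.
  have -> : cos (x / 2) * sin (x / 2) *+ 2 / (sin (x / 2) ^+ 2 *+ 2) =
      cos (x / 2) / sin (x / 2) by field; rewrite gt_eqF.
  rewrite -[LHS]tanK; last by rewrite in_itv/=; apply/andP; split; lra.
  rewrite /tan (_ : (pi - x) / 2 = - (x / 2 - pi / 2)); last by field.
  by rewrite sinN cosN sinBpihalf cosBpihalf opprK.
have -> : (2 * sin (x / 2)) `^ a = expR (a * logmod x 1).
  rewrite /powR gt_eqF ?mulr_gt0//; congr (expR (a * _)).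
  rewrite /logmod !mul1r cosE sinE.
  rewrite (_ : _ + _ = (2 * sin (x / 2)) ^+ 2); last first.
    transitivity ((2 * sin (x / 2)) ^+ 2 * (cos (x / 2) ^+ 2 + sin (x / 2) ^+ 2)).
      by ring.
    by rewrite cos2Dsin2 mulr1.
  by rewrite lnXn ?mulr_gt0//; field.
rewrite (_ : (fun N => _) =
    (fun N => expR (a * logmod x 1) * W x a (psi - a * marg x 1) N 1)); last first.
  apply/funext => N; rewrite /W big_distrr/=; apply: eq_bigr => k _.
  rewrite /cos_power expr1n mulr1.
  rewrite (_ : psi - a * marg x 1 + k%:R * x + a * marg x 1 = psi + k%:R * x); last ring.
  rewrite mulNr expRN /c; field; exact: lt0r_neq0 (expR_gt0 _).
by apply: cvgMr; exact: partial_binomial_cvg.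
Qed.

End binomial_circle.

(** * Fourier inversion on the lattice *)

Section real_integrals.
Context {R : realType}.
Local Notation leb := (@lebesgue_measure R).

Lemma dominated_cvg_Rintegral (D : set R) (f_ : nat -> R -> R) (f g : R -> R) :
  measurable D -> (forall n, measurable_fun D (f_ n)) -> measurable_fun D f ->
  (forall x, D x -> f_ ^~ x @ \oo --> f x) -> leb.-integrable D (EFin \o g) ->
  (forall n x, D x -> `|f_ n x| <= g x) ->
  \int[leb]_(x in D) f_ n x @[n --> \oo] --> \int[leb]_(x in D) f x.
Proof.
move=> mD mf_ mf f_f ig f_g.
have [|||||+ _ H] := @dominated_convergence _ _ _ leb D mD
    (fun n => EFin \o f_ n) (EFin \o f) (EFin \o g).
- by move=> n; apply/measurable_EFinP; exact: mf_.
- by apply/measurable_EFinP; exact: mf.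
- by apply: aeW => x Dx; apply: cvg_EFin; [exact: nearW|exact: f_f].
- exact: ig.
- by apply: aeW => x n Dx; rewrite lee_fin f_g.
move=> If; apply: fine_cvg; rewrite fineK//; exact: integrable_fin_num.
Qed.

Lemma integrable_addr (a b : R) (f g : R -> R) :
  leb.-integrable `]a, b] (EFin \o f) -> leb.-integrable `]a, b] (EFin \o g) ->
  leb.-integrable `]a, b] (EFin \o (fun x => f x + g x)).
Proof. by move=> If Ig; apply: (integrableD _ If Ig). Qed.

Lemma integrable_mulr (a b c : R) (f : R -> R) :
  leb.-integrable `]a, b] (EFin \o f) ->
  leb.-integrable `]a, b] (EFin \o (fun x => c * f x)).
Proof. by move=> If; apply: (integrableZl _ c If). Qed.

Lemma integrable_bounded_oc (f : R -> R) (M C : R) : measurable_fun `]0, M] f ->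
  (forall x, 0 < x <= M -> `|f x| <= C) -> leb.-integrable `]0, M] (EFin \o f).
Proof.
move=> mf fC; apply: measurable_bounded_integrable => //.
  by rewrite /= lebesgue_measure_itv/=; case: ifP => _; rewrite -?EFinD ?ltry.
exists C; split; first exact: num_real.
by move=> y Cy x /=; rewrite in_itv/= => /fC /le_trans; apply; exact: ltW.
Qed.

Lemma Rintegral_cos (b M : R) : b != 0 -> 0 < M ->
  \int[leb]_(x in `]0, M]) cos (x * b) = sin (M * b) / b.
Proof.
move=> b0 M0.
have cc : continuous (fun x : R => cos (x * b)).
  move=> x; apply: (@cvg_comp _ _ _ (fun x => x * b) cos); last exact: continuous_cos.
  by apply: cvgM; [exact: cvg_id | exact: cvg_cst].
have dF x : is_derive x (1 : R) (fun x => sin (x * b) / b) (cos (x * b)).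
  have dxb := is_derive1M (is_derive_id x (1 : R)) (is_derive1_const b x).
  have ds := @is_derive1_fun R (@sin R) _ x _ _ (is_derive_sin (x * b)) dxb.
  apply: (is_derive_eq (is_derive1M ds (is_derive1_const b^-1 x))).
  by rewrite !mulr0 !addr0 mul1r mulfK.
have cF : continuous (fun x : R => sin (x * b) / b).
  by move=> x; have [dx _] := dF x; exact/differentiable_continuous/derivable1_diffP.
rewrite Rintegral_itv_obnd_cbnd; last first.
  apply: (@integrable_bounded_oc _ _ 1).
    by apply: measurable_funTS; exact: continuous_measurable_fun.
  by move=> x _; exact: cos_max.
rewrite /Rintegral (@continuous_FTC2 _ _ (fun x => sin (x * b) / b))//=.
- by rewrite mul0r sin0 mul0r subr0.
- by apply: continuous_subspaceT.
- by split=> [x _| |]; [have [] := dF x | exact/cvg_at_right_filter/cF |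
    exact/cvg_at_left_filter/cF].
- by move=> x _; rewrite derive1E; have [_ ->] := dF x.
Qed.

End real_integrals.

Section integer_valued.
Context d (T : measurableType d) (R : realType) (P : probability T R).
Implicit Types (A B : set T) (Z : {RV P >-> int}).
Local Notation pr A := (fine (P A)).

Lemma measurable_preim_int Z (B : set int) : measurable (Z @^-1` B).
Proof. by rewrite -[X in measurable X]setTI; exact: measurable_funP. Qed.

(** Pairing k with - k matches the truncation of the cosine series, so that sums over the integers
    are always limits of these symmetric partial sums. The event [A] will carry a condition on the
    whole walk. *)
Lemma probability_setI_abs_le Z A m : measurable A ->
  pr (A `&` [set w | (`|Z w| <= m)%N]) = pr (A `&` [set w | Z w = 0]) +
    \sum_(1 <= k < m.+1) (pr (A `&` [set w | Z w = k%:Z]) +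
                          pr (A `&` [set w | Z w = - k%:Z])).
Proof.
move=> mA.
have mZ (B : set int) : measurable (A `&` Z @^-1` B).
  by apply: measurableI => //; exact: measurable_preim_int.
elim: m => [|m IH].
  rewrite big_nil addr0; congr (fine (P (_ `&` _))).
  by apply/seteqP; split=> w /=; rewrite leqn0 absz_eq0 => /eqP.
rewrite big_nat_recr//= addrA -IH.
have -> : A `&` [set w | (`|Z w| <= m.+1)%N] =
    (A `&` Z @^-1` [set k | (`|k| <= m)%N]) `|`
    ((A `&` Z @^-1` [set k | k = m.+1%:Z]) `|` (A `&` Z @^-1` [set k | k = - m.+1%:Z])).
  rewrite -!setIUr; congr (_ `&` _); apply/seteqP; split=> w /=.
    rewrite leq_eqVlt ltnS => /orP[/eqP h|]; last by left.
    right; have [Z0|Z0] := leP 0 (Z w); [left|right].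
      by rewrite -h gez0_abs.
    by rewrite -h ltz0_abs// opprK.
  by move=> [/leqW//|[->|->]]; rewrite ?abszN absz_nat.
rewrite measureU//; last 2 first.
- by apply: measurableU; exact: mZ.
- rewrite -setIUr -setIIr; apply/seteqP; split=> // w [_ []] /= + [] E.
    by rewrite E absz_nat ltnn.
  by rewrite E abszN absz_nat ltnn.
rewrite measureU//; last first.
  by rewrite -setIIr; apply/seteqP; split=> // w [_ []] /= ->.
rewrite !fineD ?fin_numD ?fin_num_measure//; try exact: mZ.
Qed.

Lemma probability_setI_abs_cvg Z A : measurable A ->
  pr (A `&` [set w | (`|Z w| <= m)%N]) @[m --> \oo] --> pr A.
Proof.
move=> mA; apply: fine_cvg; rewrite fineK ?fin_num_measure//.
have {2}-> : A = \bigcup_m (A `&` [set w | (`|Z w| <= m)%N]).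
  by apply/seteqP; split=> [w Aw|w [m _ []]//]; exists `|Z w|%N => //=.
have mZ m : measurable (A `&` [set w | (`|Z w| <= m)%N]).
  by apply: measurableI => //; exact: (measurable_preim_int Z [set k | (`|k| <= m)%N]).
apply: nondecreasing_cvg_mu => //.
  exact: bigcup_measurable.
move=> m n mn; apply/subsetPset; apply: setIS => w /= /leq_trans; exact.
Qed.

Lemma measurable_preim_of_points (N : T -> int) (B : set int) :
  (forall k, measurable [set w | N w = k]) -> measurable [set w | B (N w)].
Proof.
move=> mN; rewrite (_ : [set w | _] = \bigcup_(k in B) [set w | N w = k]).
  rewrite bigcup_mkcond; apply: countable_bigcupT_measurable => // k.
  by case: ifP.
by apply/seteqP; split=> [w Bw|w [k Bk /= ->]//]; exists (N w).
Qed.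

Lemma measurable_walk (Y : nat -> {RV P >-> int}) n (B : set int) :
  measurable [set w | B (\sum_(m < n) Y m w)].
Proof.
apply: (measurable_preim_of_points (N := fun w => \sum_(m < n) Y m w)).
elim: n => [|n IH] k.
  have -> : [set w | \sum_(m < 0) Y m w = k] = if 0 == k then setT else set0.
    by apply/seteqP; split=> w; rewrite /= big_ord0; case: eqP.
  by case: ifP.
have -> : [set w | \sum_(m < n.+1) Y m w = k] =
    \bigcup_(i in [set: int])
      ([set w | \sum_(m < n) Y m w = i] `&` [set w | Y n w = k - i]).
  apply/seteqP; split=> w /=; rewrite big_ord_recr/=.
    move=> <-; exists (\sum_(m < n) Y m w) => //.
    by split => //=; rewrite addrAC subrr add0r.
  by move=> [i _ [/= <- ->]]; rewrite addrC subrK.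
apply: countable_bigcupT_measurable => // i.
by apply: measurableI => //; exact: (measurable_preim_int (Y n) [set k - i]).
Qed.

End integer_valued.

Section lattice_inversion.
Context d (T : measurableType d) (R : realType) (P : probability T R).
Variables (Y : nat -> {RV P >-> int}) (p : int -> R) (phi : R -> R) (s : nat).
Local Notation leb := (@lebesgue_measure R).
Local Notation pr A := (fine (P A)).
Hypothesis Y_indep : mutually_independent Y.
Hypothesis Y_law : forall m k, P [set w | Y m w = k] = (p k)%:E.
Hypothesis p_sym : forall k, p (- k) = p k.
Hypothesis phi_meas : measurable_fun [set: R] phi.
Hypothesis phi_cvg : forall x, 0 < x <= pi ->
  (fun m => p 0 + 2 * \sum_(1 <= k < m.+1) p k%:Z * cos (k%:R * x)) @ \oo --> phi x.
Hypothesis s_gt0 : (0 < s)%N.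
(** The steps lie in 1 + s Z, hence the walk after n steps lies in n + s Z. *)
Hypothesis p_span : forall k : int, p k != 0 -> (s%:Z %| k - 1)%Z.

Let cospoly m x := p 0 + 2 * \sum_(1 <= k < m.+1) p k%:Z * cos (k%:R * x).

Lemma law_ge0 k : 0 <= p k.
Proof. by rewrite -lee_fin -(Y_law 0). Qed.

(** The coefficients are nonnegative and add up to P(|Y_1| <= m). This bound, uniform in m, is the
    domination used in [fourier_coefS]. *)
Lemma cospoly_le1 m x : `|cospoly m x| <= 1.
Proof.
have := probability_setI_abs_le (Y 0) m (@measurableT _ T).
have prp k : pr ([set: T] `&` [set w | Y 0 w = k]) = p k by rewrite setTI Y_law.
rewrite prp (eq_bigr (fun k => 2 * p k%:Z)); last first.
  by move=> k _; rewrite !prp p_sym mulr_natl mulr2n.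
move=> E; have : pr ([set: T] `&` [set w | (`|Y 0 w| <= m)%N]) <= 1.
  rewrite -lee_fin fineK ?fin_num_measure ?probability_le1//;
    by apply: measurableI => //; exact: (measurable_preim_int (Y 0) [set k | (`|k| <= m)%N]).
rewrite {}E => /(le_trans _); apply.
rewrite (le_trans (ler_normD _ _))// ger0_norm ?law_ge0// lerD2l.
rewrite -mulr_sumr normrM ger0_norm// ler_wpM2l//.
rewrite (le_trans (ler_norm_sum _ _ _))//; apply: ler_sum => k _.
rewrite normrM ger0_norm ?law_ge0// -[leRHS]mulr1.
by rewrite ler_wpM2l ?law_ge0// cos_max.
Qed.

Lemma law_sum_cvg1 : p 0 + 2 * \sum_(1 <= k < m.+1) p k%:Z @[m --> \oo] --> (1 : R).
Proof.
have := probability_setI_abs_cvg (Y 0) (@measurableT _ T).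
rewrite probability_setT; apply: cvg_trans; apply: near_eq_cvg; apply: nearW => m /=.
rewrite probability_setI_abs_le//.
have prp k : pr ([set: T] `&` [set w | Y 0 w = k]) = p k by rewrite setTI Y_law.
rewrite prp; congr (_ + _); rewrite mulr_sumr; apply: eq_bigr => k _.
by rewrite !prp p_sym mulr_natl mulr2n.
Qed.

Lemma cospoly_lim_le1 x : 0 < x <= pi -> `|phi x| <= 1.
Proof.
move=> /phi_cvg /cvg_norm H; rewrite -(cvg_lim _ H)//.
apply: limr_le; first by apply: cvgP H.
by apply: nearW => m; exact: cospoly_le1.
Qed.

Variable h : R.
Hypothesis h_gt0 : 0 < h.
Let M := pi / (s%:R * h).

Let M_gt0 : 0 < M.
Proof. by rewrite divr_gt0 ?pi_gt0// mulr_gt0// ltr0n. Qed.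

Let hM x : 0 < x <= M -> 0 < h * x <= pi.
Proof.
move=> /andP[x0 xM]; rewrite mulr_gt0//=.
have -> : pi = s%:R * (h * M).
  by rewrite /M; field; rewrite pnatr_eq0 -lt0n s_gt0 gt_eqF.
rewrite (@le_trans _ _ (h * M))// ?ler_wpM2l ?(ltW h_gt0)//.
by rewrite ler_peMl ?ler1n// ltW// mulr_gt0.
Qed.

(** The usual inversion integral over ]- pi / h, pi / h], folded: for j in n + s Z its integrand has
    period 2 pi / (s h) and is even up to the imaginary part, whence the factor s and the upper
    bound [M]. *)
Definition fourier_coef n (j : int) : R := s%:R * h / pi *
  \int[leb]_(x in `]0, M]) (cos (x * (h * j%:~R)) * phi (h * x) ^+ n).

Let mcos (a : R) : measurable_fun [set: R] (fun x => cos (x * a)).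
Proof.
apply: measurableT_comp; last by apply: measurable_funM.
by apply: continuous_measurable_fun; exact: continuous_cos.
Qed.

Let mphi n : measurable_fun [set: R] (fun x => phi (h * x) ^+ n).
Proof.
by apply: measurable_funX; apply: measurableT_comp.
Qed.

Let phi_le1 n x : 0 < x <= M -> `|phi (h * x) ^+ n| <= 1.
Proof. by move=> /hM /cospoly_lim_le1 ?; rewrite normrX exprn_ile1. Qed.

Let int_cos_phi n a : leb.-integrable `]0, M]
  (EFin \o (fun x => cos (x * a) * phi (h * x) ^+ n)).
Proof.
apply: (@integrable_bounded_oc _ _ _ 1).
  by apply: measurable_funTS; exact: measurable_funM.
move=> x xM; rewrite normrM -[leRHS]mulr1 ler_pM// ?cos_max//.
exact: phi_le1.
Qed.

(** For j = s q the product M h j is q pi, so the sine in the primitive vanishes; on the shortened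
    interval this needs j to be a multiple of s. *)
Lemma fourier_coef0 (j : int) : (s%:Z %| j)%Z -> fourier_coef 0 j = (j == 0)%:R.
Proof.
move=> /dvdzP[q jE]; have pi00 : pi != 0 :> R by rewrite gt_eqF ?pi_gt0.
have h0 : h != 0 by rewrite gt_eqF.
have s0 : s%:R != 0 :> R by rewrite pnatr_eq0 -lt0n.
rewrite /fourier_coef; under eq_Rintegral do rewrite expr0 mulr1.
have [->|j0] := eqVneq j 0.
  under eq_Rintegral do rewrite !mulr0 cos0.
  rewrite Rintegral_cst//= lebesgue_measure_itv/= lte_fin M_gt0/= subr0 /M.
  by move: pi pi00 => q0 q00; field; rewrite h0 s0 q00.
rewrite Rintegral_cos//; last by rewrite mulf_neq0 ?intr_eq0.
rewrite (_ : M * _ = q%:~R * pi); last first.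
  by rewrite /M jE intrM; field; rewrite h0 s0.
have sinpiM (k : nat) : sin (k%:R * pi) = 0 :> R.
  elim: k => [|k IH]; first by rewrite mul0r sin0.
  by rewrite -natr1 mulrDl mul1r sinDpi IH oppr0.
case: q {jE} => q; first by rewrite -pmulrn sinpiM mul0r mulr0.
by rewrite NegzE mulrNz -pmulrn mulNr sinN sinpiM oppr0 mul0r mulr0.
Qed.

(** Convolution with the step law multiplies the integrand by phi: cos (u - v) + cos (u + v) = 2 cos
    u cos v turns the partial sums into integrals against [cospoly], and dominated convergence
    replaces [cospoly] by phi. *)
Lemma fourier_coefS n (j : int) :
  p 0 * fourier_coef n j + \sum_(1 <= k < m.+1)
    (p k%:Z * fourier_coef n (j - k%:Z) + p (- k%:Z) * fourier_coef n (j - (- k%:Z)))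
  @[m --> \oo] --> fourier_coef n.+1 j.
Proof.
pose g m x := cos (x * (h * j%:~R)) * phi (h * x) ^+ n * cospoly m (h * x).
have mg m : measurable_fun [set: R] (g m).
  apply: measurable_funM; first exact: measurable_funM.
  apply: measurable_funD => //; apply: measurable_funM => //.
  apply: measurable_sum => k; apply: measurable_funM => //.
  rewrite (_ : (fun x => _) = (fun x => cos (x * (k%:R * h)))) //.
  by apply/funext => x; congr cos; ring.
have g_le1 m x : 0 < x <= M -> `|g m x| <= 1.
  move=> xM; rewrite normrM -[leRHS]mulr1 ler_pM// ?cospoly_le1// normrM.
  by rewrite -[leRHS]mulr1 ler_pM// ?cos_max// phi_le1.
have ig m : leb.-integrable `]0, M] (EFin \o g m).
  by apply: (@integrable_bounded_oc _ _ _ 1); [exact: measurable_funTS|exact: g_le1].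
have -> : (fun m => p 0 * fourier_coef n j + \sum_(1 <= k < m.+1)
    (p k%:Z * fourier_coef n (j - k%:Z) + p (- k%:Z) * fourier_coef n (j - (- k%:Z)))) =
  (fun m => s%:R * h / pi * \int[leb]_(x in `]0, M]) g m x).
  apply/funext; elim => [|m IH].
    rewrite big_nil addr0 /fourier_coef mulrCA; congr (_ * _).
    rewrite -RintegralZl//; apply: eq_Rintegral => x _.
    by rewrite /g /cospoly big_nil mulr0 addr0 mulrC.
  rewrite big_nat_recr//= addrA {}IH p_sym opprK /fourier_coef.
  rewrite (_ : \int[leb]_(x in `]0, M]) g m.+1 x = \int[leb]_(x in `]0, M]) g m x +
    p m.+1 *
      (\int[leb]_(x in `]0, M]) (cos (x * (h * (j - m.+1%:Z)%:~R)) * phi (h * x) ^+ n) +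
       \int[leb]_(x in `]0, M]) (cos (x * (h * (j + m.+1%:Z)%:~R)) * phi (h * x) ^+ n)));
    last first.
    have i1 a := int_cos_phi n a.
    have i2 a b := integrable_addr (i1 a) (i1 b).
    have i3 a b c := integrable_mulr c (i2 a b).
    rewrite -RintegralD// -RintegralZl// -RintegralD//; apply: eq_Rintegral => x _.
    rewrite /g /cospoly big_nat_recr//= intrB intrD -!pmulrn mulrDr.
    rewrite (_ : x * (h * (j%:~R - m.+1%:R)) = x * (h * j%:~R) - m.+1%:R * (h * x));
      last by ring.
    rewrite (_ : x * (h * (j%:~R + m.+1%:R)) = x * (h * j%:~R) + m.+1%:R * (h * x));
      last by ring.
    by rewrite cosB cosD; ring.
  by ring.
apply: cvgMr; apply: (@dominated_cvg_Rintegral _ _ _ _ (fun=> 1)).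
- by [].
- by move=> m; exact: measurable_funTS.
- by apply: measurable_funTS; apply: measurable_funM => //; exact: mphi n.+1.
- move=> x /=; rewrite in_itv/= => xM.
  rewrite exprS mulrCA mulrC; apply: cvgMr; apply: phi_cvg; exact: hM.
- by apply: (@integrable_bounded_oc _ _ _ 1) => // x _; rewrite normr1.
- by move=> m x /=; rewrite in_itv/=; exact: g_le1.
Qed.

Let walk n w : int := \sum_(m < n) Y m w.

(* The extra events [A i], [i >= n], carry the induction on [n]: each step takes
   the next increment [Y n] out of them. *)
Lemma walk_inversion_gen n (j : int) (J : {fset nat}) (A : nat -> set int) :
  (s%:Z %| j - n%:Z)%Z -> (forall i, i \in J -> (n <= i)%N) ->
  pr ([set w | walk n w = j] `&` \bigcap_(i in [set` J]) (Y i @^-1` A i)) =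
  fourier_coef n j * \prod_(i <- J) pr (Y i @^-1` A i).
Proof.
have fine_prod (I : seq nat) (B : nat -> set int) :
    fine (\prod_(i <- I) P (Y i @^-1` B i))%E = \prod_(i <- I) pr (Y i @^-1` B i).
  have -> : (\prod_(i <- I) P (Y i @^-1` B i) =
      (\prod_(i <- I) pr (Y i @^-1` B i))%:E)%E.
    elim: I => [|i I IH]; first by rewrite !big_nil.
    by rewrite !big_cons IH EFinM fineK// fin_num_measure//; exact: measurable_preim_int.
  by [].
elim: n j J A => [|n IH] j J A sj Jn.
  rewrite subr0 in sj; rewrite fourier_coef0//.
  have -> : [set w | walk 0 w = j] = if j == 0 then setT else set0.
    apply/seteqP; split=> w; rewrite /walk /= big_ord0 eq_sym; case: eqP => //.
  have [_|_] := eqVneq j 0; last by rewrite set0I measure0 mul0r.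
  by rewrite setTI Y_indep// fine_prod mul1r.
set E := \bigcap_(i in _) _; set c := \prod_(i <- J) _.
have mE : measurable E.
  apply: fin_bigcap_measurable; first exact: finite_fset.
  by move=> i _; exact: measurable_preim_int.
have mA : measurable ([set w | walk n.+1 w = j] `&` E).
  by apply: measurableI => //; exact: (measurable_walk Y n.+1 [set j]).
have nJ : n \notin J by apply/negP => /Jn; rewrite ltnn.
have step k : pr (([set w | walk n.+1 w = j] `&` E) `&` [set w | Y n w = k]) =
    p k * fourier_coef n (j - k) * c.
  (* When p k = 0, j - k may leave the residue class required by the induction hypothesis; the event
     is then null, being contained in Y n = k. *)
  have [pk0|pk0] := eqVneq (p k) 0.
    rewrite pk0 !mul0r; suff -> : P (([set w | walk n.+1 w = j] `&` E) `&`
        [set w | Y n w = k]) = 0%E by [].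
    apply/eqP; rewrite eq_le measure_ge0 andbT -[leRHS]/((0:R)%:E) -pk0 -(Y_law n).
    by apply: le_measure; rewrite ?inE//; [apply: measurableI => //|];
      exact: (measurable_preim_int (Y n) [set k]).
  (* The condition Y n = k joins the extra events, under the index n that was still free. *)
  pose A' i := if i == n then [set k] else A i.
  have -> : ([set w | walk n.+1 w = j] `&` E) `&` [set w | Y n w = k] =
      [set w | walk n w = j - k] `&` \bigcap_(i in [set` (n |` J)%fset]) (Y i @^-1` A' i).
    apply/seteqP; split=> w.
      move=> [[/= + Ew] Yk]; rewrite /walk big_ord_recr/= => wj; split.
        by rewrite /= -wj -Yk addrK.
      move=> i /=; rewrite in_fset1U /A'; case: eqVneq => [-> _|_ /= iJ]; first by [].
      exact: Ew.
    move=> [/= wj EA]; have Yk : Y n w = k.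
      by have := EA n; rewrite /= in_fset1U eqxx /A' eqxx; exact.
    split=> //; split; first by rewrite /= /walk big_ord_recr/= Yk -/(walk n w) wj subrK.
    move=> i iJ; have := EA i; rewrite /= in_fset1U /A' iJ orbT.
    case: eqVneq => [ein|_]; last exact.
    by move: nJ; rewrite -ein iJ.
  rewrite IH; last 2 first.
  - have -> : j - k - n%:Z = (j - n.+1%:Z) - (k - 1) by rewrite -addn1 PoszD; ring.
    by apply: rpredB => //; exact: p_span.
  - by move=> i; rewrite in_fset1U => /orP[/eqP->//|/Jn/ltnW].
  rewrite big_fsetU1//= {1}/A' eqxx mulrCA mulrA; congr (_ * _ * _).
    by rewrite (_ : _ @^-1` _ = [set w | Y n w = k])// Y_law.
  rewrite /c big_seq [RHS]big_seq; apply: eq_bigr => i iJ.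
  rewrite /A'; case: eqVneq => // ein.
  by move: nJ; rewrite -ein iJ.
have := probability_setI_abs_cvg (Y n) mA.
have -> : (fun m => pr (([set w | walk n.+1 w = j] `&` E) `&`
    [set w | (`|Y n w| <= m)%N])) =
    (fun m => (p 0 * fourier_coef n j + \sum_(1 <= k < m.+1)
    (p k%:Z * fourier_coef n (j - k%:Z) + p (- k%:Z) * fourier_coef n (j - (- k%:Z)))) * c).
  apply/funext => m; rewrite probability_setI_abs_le// step subr0 mulrDl mulr_suml.
  by congr (_ + _); apply: eq_bigr => k _; rewrite !step mulrDl.
move=> /cvg_unique; apply => //.
by apply: cvgMl; exact: fourier_coefS.
Qed.

Lemma walk_inversion n (j : int) : (s%:Z %| j - n%:Z)%Z ->
  pr [set w | \sum_(m < n) Y m w = j] = fourier_coef n j.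
Proof.
move=> sj; have := @walk_inversion_gen n j fset0 (fun=> setT) sj.
rewrite big_seq_fset0 mulr1 => <-//.
by congr (fine (P _)); apply/seteqP; split=> [w /= ?|w []]//; split.
Qed.

End lattice_inversion.

(** * The stable density as a cosine integral *)

Section stable_density_cosine.
Context {R : realType}.
Local Notation leb := (@lebesgue_measure R).
Implicit Types (a c t x y : R).

Lemma measurable_expR_powR c a : measurable_fun [set: R] (fun x => expR (- c * x `^ a)).
Proof.
by apply: measurableT_comp; [exact: measurable_expR|exact: measurable_funM].
Qed.

(** Comparison with the arctangent density, whose integral is known: one Taylor term y^(m+1) /
    (m+1)! of exp y, at y = c x^a with a (m+1) >= 2, already beats x^2. *)
Lemma expR_powR_le c a : 0 < c -> 0 < a ->
  exists2 C, 0 < C & forall x, 0 <= x -> expR (- c * x `^ a) <= C * (1 + x ^+ 2)^-1.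
Proof.
move=> c0 a0.
have [m] : exists m : nat, 2 <= a * m.+1%:R.
  exists (Num.bound (2 / a)); rewrite mulrC -ler_pdivrMr//.
  have := @archi_boundP _ (2 / a); rewrite divr_ge0// ?(ltW a0)// => /(_ isT)/ltW.
  by move=> /le_trans; apply; rewrite ler_nat.
(* For x > 1 the Taylor term times [K] is at least 2 x^2 >= 1 + x^2; for x <= 1 the constant 2
   bounds 1 + x^2. *)
move=> am; set K := 2 * m.+1`!%:R / c ^+ m.+1.
have K0 : 0 <= K by rewrite divr_ge0// ?exprn_ge0// ltW.
exists (2 + K); first by rewrite ltr_wpDr.
move=> x x0.
have q0 : 0 < 1 + x ^+ 2 by rewrite ltr_pwDl ?sqr_ge0.
rewrite ler_pdivlMr//; have [x1|x1] := leP x 1; last first.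
  have {}x0 := lt_trans ltr01 x1.
  rewrite (@le_trans _ _ K)//; last by rewrite lerDr.
  have y0 : 0 < c * x `^ a by rewrite mulr_gt0// powR_gt0.
  rewrite mulNr expRN mulrC ler_pdivrMr ?expR_gt0//.
  rewrite (@le_trans _ _ (2 * x ^+ 2))//.
    by rewrite mulr_natl mulr2n lerD2r exprn_ege1// ltW.
  rewrite (@le_trans _ _ (K * ((c * x `^ a) ^+ m.+1 / m.+1`!%:R)))//; last first.
    rewrite ler_wpM2l// (le_trans _ (expR_ge1Dxn m (ltW y0)))//.
    by rewrite lerDr.
  have f0 : m.+1`!%:R != 0 :> R by rewrite pnatr_eq0 -lt0n fact_gt0.
  rewrite exprMn (_ : K * _ = 2 * (x `^ a) ^+ m.+1); last first.
    rewrite /K; set F := m.+1`!%:R; rewrite -/F in f0.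
    have c1 : c ^+ m.+1 != 0 by rewrite expf_neq0// gt_eqF.
    by move: (c ^+ m.+1) c1 F f0 => C C0 F F0; field; rewrite C0 F0.
  rewrite ler_wpM2l// -[leRHS]powR_mulrn ?powR_ge0// -powRrM.
  by rewrite -powR_mulrn ?(ltW x0)// ler_powR// ltW.
rewrite (@le_trans _ _ (1 * 2))//; last by rewrite mul1r lerDl.
rewrite ler_pM ?expR_ge0 ?(ltW q0)//.
  by rewrite mulNr -expR0 ler_expR oppr_le0 mulr_ge0 ?powR_ge0// ltW.
by rewrite -[leRHS]/(1 + 1) lerD2l expr_le1// ltW.
Qed.

Lemma integrable_expR_powR c a : 0 < c -> 0 < a ->
  leb.-integrable setT (EFin \o (fun x => expR (- c * `|x| `^ a))).
Proof.
move=> c0 a0; have [C C0 H] := expR_powR_le c0 a0.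
have q0 (x : R) : 0 <= (oneDsqr x)^-1 by rewrite invr_ge0 (le_trans _ (oneDsqr_ge1 x)).
have i1 : leb.-integrable setT (EFin \o (fun x : R => (1 + x ^+ 2)^-1)).
  apply/integrableP; split.
    apply/measurable_EFinP.
    by apply: continuous_measurable_fun; exact: continuous_oneDsqrV.
  rewrite (_ : (\int[leb]_x _)%E = (\int[leb]_x ((oneDsqr x)^-1)%:E)%E); last first.
    by apply: eq_integral => x _ /=; rewrite ger0_norm//; exact: q0.
  rewrite ge0_symfun_integralT//.
  - rewrite (_ : [set x : R | _] = `[0, +oo[%classic); last first.
      by apply/seteqP; split=> x /=; rewrite in_itv/= andbT.
    by rewrite integral0y_oneDsqr -EFinM ltry.
  - by move=> x; exact: continuous_oneDsqrV.
  - by move=> x; rewrite /= /oneDsqr sqrrN.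
have ig : leb.-integrable setT (EFin \o (fun x => C * (1 + x ^+ 2)^-1)).
  exact: (integrableZl measurableT C i1).
apply: (le_integrable _ _ _ ig) => //.
  apply/measurable_EFinP; apply: measurableT_comp; first exact: measurable_expR.
  apply: measurable_funM => //.
  by apply: (measurableT_comp (measurable_powR a)); exact: normr_measurable.
move=> x _ /=.
rewrite lee_fin ger0_norm ?expR_ge0// (le_trans (H `|x| _))// real_normK ?num_real//.
exact: ler_norm.
Qed.

Lemma Rintegral_even (f : R -> R) : (forall x, f (- x) = f x) ->
  leb.-integrable setT (EFin \o f) ->
  \int[leb]_x f x = 2 * \int[leb]_(x in `]0, +oo[) f x.
Proof.
move=> fN If; have mf : measurable_fun [set: R] f.
  by apply/measurable_EFinP; exact: measurable_int If.
(* [g] is odd, so adding its integral doubles [f] on the positive half-line and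
   cancels it on the negative one. *)
pose g x := Num.sg x * f x.
have mg : measurable_fun [set: R] g.
  apply: measurable_funM => //.
  rewrite (_ : Num.sg = (\1_(`]0, +oo[%classic : set R) \- \1_`]-oo, 0[%classic : R -> R)).
    by apply: measurable_funB; exact: measurable_indic.
  apply/funext => x; rewrite /= !indicE !mem_setE/= !in_itv/= andbT.
  by case: sgrP; rewrite ?subr0 ?sub0r ?subrr.
have Ig : leb.-integrable setT (EFin \o g).
  apply: (le_integrable _ _ _ If) => //; first exact/measurable_EFinP.
  move=> x _; rewrite lee_fin normrM ler_piMl//.
  by rewrite normr_sg; case: (x == 0).
have g0 : \int[leb]_x g x = 0.
  by apply: Rintegral_odd => // x; rewrite /g sgrN fN mulNr.
transitivity (\int[leb]_x f x + \int[leb]_x g x); first by rewrite g0 addr0.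
rewrite -RintegralD//.
have Ifg : leb.-integrable setT (EFin \o (fun x => f x + g x)).
  exact: (integrableD _ If Ig).
have TE : [set: R] = `]-oo, 0[ `|` `[0, +oo[.
  by apply/seteqP; split=> // x _ /=; rewrite !in_itv/= andbT; case: ltP; [left|right].
rewrite [in LHS]TE Rintegral_setU//; last 2 first.
- by rewrite -TE.
- by apply/disj_setPS => x [] /=; rewrite !in_itv/= andbT ltNge => /negbTE ->.
rewrite (_ : \int[leb]_(x in `]-oo, 0[) _ = 0) ?add0r; last first.
  rewrite /Rintegral integral0_eq// => x /=; rewrite in_itv/= => x0.
  by rewrite /g ltr0_sg// mulN1r subrr.
rewrite -Rintegral_itv_obnd_cbnd; last exact: integrableS Ifg.
rewrite -RintegralZl//; last exact: integrableS If.
apply: eq_Rintegral => x; rewrite inE/= in_itv/= andbT => x0.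
by rewrite /g gtr0_sg// mul1r mulr_natl mulr2n.
Qed.

Lemma integrable_cos_expR_powR a t y : 0 < a -> 0 < t ->
  leb.-integrable setT (EFin \o (fun x => cos (x * y) * expR (- t * `|x| `^ a))).
Proof.
move=> a0 t0; have I := integrable_expR_powR t0 a0.
apply: (le_integrable _ _ _ I) => //.
  apply/measurable_EFinP; apply: measurable_funM.
    apply: measurableT_comp; last exact: measurable_funM.
    by apply: continuous_measurable_fun; exact: continuous_cos.
  by apply/measurable_EFinP; exact: measurable_int I.
move=> x _; rewrite lee_fin normrM ler_piMl//; exact: cos_max.
Qed.

Lemma stable_density_cos a t y : 0 < a -> 0 < t ->
  stable_density a t y =
  pi^-1 * \int[leb]_(x in `]0, +oo[) (cos (x * y) * expR (- t * x `^ a)).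
Proof.
move=> a0 t0; rewrite /stable_density /= !mul0r subr0.
have cancel2 (p I : R) : (2 * p)^-1 * (2 * I) = p^-1 * I.
  by rewrite invfM mulrACA mulVf ?mul1r// pnatr_eq0.
under eq_Rintegral do rewrite mulr0 subr0 cosN.
rewrite Rintegral_even; [|by move=> x; rewrite mulNr cosN normrN|
  exact: integrable_cos_expR_powR].
rewrite cancel2; apply: (congr1 (fun I => pi^-1 * I)).
by apply: eq_Rintegral => x; rewrite inE/= in_itv/= andbT => x0; rewrite gtr0_norm.
Qed.

Lemma cvg_expR_powern (u : nat -> R) L : u @ \oo --> 0 ->
  (fun n => n%:R * u n) @ \oo --> L ->
  (fun n => (1 - u n) ^+ n) @ \oo --> expR (- L).
Proof.
move=> u0 nu.
(* For u < 1 of either sign, exp (- u / (1 - u)) <= 1 - u <= exp (- u); the left inequality is 1 + v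
   <= exp v at v = u / (1 - u), since 1 + v = 1 / (1 - u). *)
apply: (@squeeze_cvgr _ _ _ _ (fun n => expR (- (n%:R * u n / (1 - u n))))
  (fun n => expR (- (n%:R * u n)))).
- near=> n.
  have un : u n < 1 by near: n; exact: (cvgr_lt 0 u0).
  have v0 : 0 < 1 - u n by rewrite subr_gt0.
  rewrite -mulrA -!mulrN !expRM_natl !lerXn2r ?nnegrE ?expR_ge0 ?(ltW v0)//.
    by rewrite (le_trans _ (expR_ge1Dx _)).
  rewrite mulrN expRN invf_ple ?posrE ?expR_gt0//.
  rewrite (le_trans _ (expR_ge1Dx _))//.
  suff -> : 1 + u n / (1 - u n) = (1 - u n)^-1 by [].
  by field; rewrite gt_eqF.
- apply: continuous_cvg; first exact: continuous_expR.
  apply: cvgN; rewrite -[L]divr1; apply: cvgM => //; apply: cvgV => //.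
  by rewrite -[X in _ --> X]subr0; apply: cvgB => //; exact: cvg_cst.
- by apply: continuous_cvg; [exact: continuous_expR|exact: cvgN].
Unshelve. all: by end_near. Qed.

End stable_density_cosine.

(** * Local limit theorem *)

Section local_limit.
Context {R : realType}.
Local Notation leb := (@lebesgue_measure R).
Variables (phi : R -> R) (s : nat) (alpha mu t c : R) (h : nat -> R).
Hypotheses (alpha_gt0 : 0 < alpha) (mu_gt0 : 0 < mu) (t_gt0 : 0 < t) (c_gt0 : 0 < c).
Hypothesis s_gt0 : (0 < s)%N.
Hypothesis phi_meas : measurable_fun [set: R] phi.
Hypothesis phi_le : forall x, 0 < x <= pi / s%:R -> `|phi x| <= expR (- c * x `^ alpha).
Hypothesis phi_asymp : (1 - phi x) / x `^ alpha @[x --> 0^'+] --> mu.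
Hypothesis h_gt0 : forall n : nat, (0 < n)%N -> 0 < h n.
Hypothesis h_scaling : forall n : nat, (0 < n)%N -> t / n%:R = mu * h n `^ alpha.

Lemma natr_mul_scaling n : (0 < n)%N -> n%:R * h n `^ alpha = t / mu.
Proof.
move=> n0; have nn : n%:R != 0 :> R by rewrite pnatr_eq0 -lt0n.
apply: (mulfI (lt0r_neq0 mu_gt0)); rewrite mulrCA -h_scaling//.
by rewrite mulrCA mulfV// mulr1 mulrCA mulfV ?mulr1// gt_eqF.
Qed.

Lemma scaling_near_lt e : 0 < e -> \forall n \near \oo, h n < e.
Proof.
move=> e0; have K0 : 0 < mu * e `^ alpha by rewrite mulr_gt0// powR_gt0.
near=> n; have n0 : (0 < n)%N by near: n; exact: nbhs_infty_gt.
rewrite ltNge; apply/negP => eh.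
have : mu * e `^ alpha <= t / n%:R.
  by rewrite h_scaling// ler_wpM2l ?(ltW mu_gt0)// ge0_ler_powR// ?nnegrE ltW// h_gt0.
rewrite ler_pdivlMr ?ltr0n// -ler_pdivlMl// leNgt => /negP; apply.
by rewrite mulrC; near: n; exact: nbhs_infty_gtr.
Unshelve. all: by end_near. Qed.

Lemma scaling_cvg0 : h @ \oo --> 0.
Proof.
apply/cvgrPdist_lt => e e0; near=> n.
have n0 : (0 < n)%N by near: n; exact: nbhs_infty_gt.
rewrite sub0r normrN gtr0_norm ?h_gt0//; near: n; exact: scaling_near_lt.
Unshelve. all: by end_near. Qed.

Lemma cvg_phi_power x : 0 < x ->
  (fun n => phi (h n * x) ^+ n) @ \oo --> expR (- t * x `^ alpha).
Proof.
move=> x0.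
have hx0 : h n * x @[n --> \oo] --> 0^'+.
  have H : h n * x @[n --> \oo] --> 0.
    by rewrite -(mul0r x); apply: cvgMl; exact: scaling_cvg0.
  move=> A /= A0; have HA : \forall n \near \oo, 0 < h n * x -> A (h n * x) := H _ A0.
  suff : \forall n \near \oo, A (h n * x) by [].
  near=> n; have n0 : (0 < n)%N by near: n; exact: nbhs_infty_gt.
  have : 0 < h n * x by rewrite mulr_gt0// h_gt0.
  by near: n.
have L : (fun n => n%:R * (1 - phi (h n * x))) @ \oo --> t * x `^ alpha.
  have := cvg_comp _ _ hx0 phi_asymp => /(cvgM (cvg_cst (t / mu * x `^ alpha))).
  rewrite (_ : t / mu * _ * mu = t * x `^ alpha); last by field; rewrite gt_eqF.
  apply: cvg_trans; apply: near_eq_cvg; near=> n.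
  have n0 : (0 < n)%N by near: n; exact: nbhs_infty_gt.
  rewrite /= powRM ?(ltW x0) ?(ltW (h_gt0 n0))// -(natr_mul_scaling n0).
  have hn0 : h n `^ alpha != 0 by rewrite gt_eqF// powR_gt0// h_gt0.
  have xn0 : x `^ alpha != 0 by rewrite gt_eqF// powR_gt0.
  by field; rewrite hn0 xn0.
under eq_fun do rewrite -[phi _](subKr 1).
rewrite mulNr; apply: cvg_expR_powern => //.
have n0 : (fun n : nat => n%:R^-1 : R) @ \oo --> 0.
  by rewrite -(cvg_shiftS (fun n : nat => n%:R^-1 : R)); exact: cvg_harmonic.
have H : (fun n => n%:R * (1 - phi (h n * x)) * n%:R^-1) @ \oo --> 0.
  by rewrite -(mulr0 (t * x `^ alpha)); exact: cvgM.
apply: cvg_trans H; apply: near_eq_cvg; near=> n.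
have nn : n%:R != 0 :> R.
  by rewrite pnatr_eq0 -lt0n; near: n; exact: nbhs_infty_gt.
by rewrite /= mulrAC mulfV// mul1r.
Unshelve. all: by end_near. Qed.

(** The walk charges one lattice point in s, so the density attached to a point mass is its quotient
    by s h. Indices start at n + 1 because the scaling relation says nothing about [h 0]. *)
Lemma local_limit (r : nat -> int) y : h n * (r n)%:~R @[n --> \oo] --> y ->
  (s%:R * h n.+1)^-1 * fourier_coef phi s (h n.+1) n.+1 (r n.+1) @[n --> \oo] -->
  stable_density alpha t y.
Proof.
move=> ry; have s0 : 0 < s%:R :> R by rewrite ltr0n.
pose M n := pi / (s%:R * h n.+1).
pose F n x := cos (x * (h n.+1 * (r n.+1)%:~R)) * phi (h n.+1 * x) ^+ n.+1.
(* Extension by zero puts all integrands on the fixed domain ]0, +oo[. *)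
pose G n := F n \_ (`]0, M n]%classic : set R).
have DM n : (`]0, M n]%classic : set R) = `]0, +oo[ `&` `]0, M n].
  by apply/seteqP; split=> x /=; rewrite !in_itv/= andbT; [move=> /andP[-> ->]|case].
have FG n : (s%:R * h n.+1)^-1 * fourier_coef phi s (h n.+1) n.+1 (r n.+1) =
    pi^-1 * \int[leb]_(x in `]0, +oo[) G n x.
  rewrite /fourier_coef -/(M n) {1}DM Rintegral_mkcondr mulrA.
  have sh0 : s%:R * h n.+1 != 0 by rewrite gt_eqF// mulr_gt0// h_gt0.
  by rewrite mulKf.
under eq_fun do rewrite FG.
rewrite stable_density_cos//; apply: cvgMr.
have mF n : measurable_fun [set: R] (F n).
  apply: measurable_funM.
    apply: measurableT_comp; last exact: measurable_funM.
    by apply: continuous_measurable_fun; exact: continuous_cos.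
  by apply: measurable_funX; apply: measurableT_comp.
have ct0 : 0 < c * (t / mu) by rewrite mulr_gt0// divr_gt0.
(* Raising [phi_le] at h x to the power n gives the exponent - c n h^alpha x^alpha, and n h^alpha =
   t / mu by scaling; hence a majorant free of n. *)
apply: (@dominated_cvg_Rintegral _ _ _ _
  (fun x => expR (- (c * (t / mu)) * `|x| `^ alpha))).
- by [].
- move=> n; apply: measurable_funTS; apply/measurable_restrict => //.
  exact: measurable_funTS.
- apply: measurable_funTS; apply: measurable_funM.
    apply: measurableT_comp; last exact: measurable_funM.
    by apply: continuous_measurable_fun; exact: continuous_cos.
  exact: measurable_expR_powR.
- move=> x; rewrite /= in_itv/= andbT => x0.
  have [N _ HN] : \forall n \near \oo, h n < pi / (x * s%:R).
    by apply: scaling_near_lt; rewrite divr_gt0 ?pi_gt0 ?mulr_gt0.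
  have hM : \forall n \near \oo, h n.+1 < pi / (x * s%:R).
    by exists N => // n /= Nn; apply: HN; exact: leqW.
  suff H : F n x @[n --> \oo] --> cos (x * y) * expR (- t * x `^ alpha).
    apply: cvg_trans H; apply: near_eq_cvg; near=> n.
    rewrite /G patchE mem_set//= in_itv/= x0/= /M.
    rewrite ler_pdivlMr ?mulr_gt0 ?h_gt0// mulrA -ler_pdivlMl ?mulr_gt0// mulrC.
    by apply/ltW; near: n; exact: hM.
  apply: cvgM.
    apply: continuous_cvg; first exact: continuous_cos.
    by apply: cvgMr; rewrite (cvg_shiftS (fun n => h n * (r n)%:~R)).
  by rewrite (cvg_shiftS (fun n => phi (h n * x) ^+ n)); exact: cvg_phi_power.
- exact: (integrableS measurableT _ _ (integrable_expR_powR ct0 alpha_gt0)).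
- move=> n x; rewrite /= in_itv/= andbT => x0.
  rewrite (gtr0_norm x0) /G patchE; case: ifPn => [|_]; last by rewrite normr0 expR_ge0.
  rewrite inE/= in_itv/= x0/= => xM.
  rewrite normrM -[leRHS]mul1r ler_pM ?cos_max// normrX.
  have hx : 0 < h n.+1 * x <= pi / s%:R.
    rewrite mulr_gt0 ?h_gt0//=.
    have hn0 := h_gt0 (ltn0Sn n).
    rewrite (le_trans (ler_wpM2l (ltW hn0) xM))// /M.
    by rewrite mulrCA invfM [s%:R^-1 * _]mulrC mulVKf// gt_eqF.
  rewrite (le_trans (lerXn2r _ _ _ (phi_le hx))) ?nnegrE ?expR_ge0//.
  rewrite -expRM_natl ler_expR powRM ?(ltW x0) ?(ltW (h_gt0 _))//.
  by rewrite -(@natr_mul_scaling n.+1)// le_eqVlt; apply/orP; left; apply/eqP; ring.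
Unshelve. all: by end_near. Qed.

End local_limit.

(** * Characteristic function of the steps *)

Section cosine_series.
Context {R : realType}.
Variables (p : nat -> R) (phi : R -> R).
Hypothesis p_ge0 : forall k, 0 <= p k.
Hypothesis p_sum : p 0 + 2 * \sum_(1 <= k < m.+1) p k @[m --> \oo] --> (1 : R).

Lemma summand_cvg0 : p @ \oo --> 0.
Proof.
have p_sum' : p 0 + 2 * \sum_(1 <= k < m.+2) p k @[m --> \oo] --> (1 : R).
  by rewrite (cvg_shiftS (fun m => p 0 + 2 * \sum_(1 <= k < m.+1) p k)).
have H : 2^-1 * ((p 0 + 2 * \sum_(1 <= k < m.+2) p k) -
    (p 0 + 2 * \sum_(1 <= k < m.+1) p k)) @[m --> \oo] --> 2^-1 * (1 - 1 : R).
  by apply: cvgMr; exact: cvgB.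
rewrite subrr mulr0 in H; rewrite -cvg_shiftS; apply: cvg_trans H.
apply: near_eq_cvg; apply: nearW => m /=.
by rewrite [\sum_(1 <= k < m.+2) _]big_nat_recr//=; field.
Qed.

Variable x : R.
Hypothesis phi_cvg :
  p 0 + 2 * \sum_(1 <= k < m.+1) p k * cos (k%:R * x) @[m --> \oo] --> phi x.

(** All terms p k (1 - cos (k x)) are nonnegative and only k = 1 is kept. This keeps phi below 1
    away from 0. *)
Lemma one_minus_cosine_series : 2 * p 1 * (1 - cos x) <= 1 - phi x.
Proof.
have H : (p 0 + 2 * \sum_(1 <= k < m.+1) p k) - (p 0 + 2 *
    \sum_(1 <= k < m.+1) p k * cos (k%:R * x)) @[m --> \oo] --> 1 - phi x.
  exact: cvgB.
rewrite -(cvg_lim _ H)//.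
apply: limr_ge; first exact: cvgP H.
exists 1%N => //= m /= m1.
rewrite opprD addrACA subrr add0r -mulrBr -sumrB -mulrA ler_wpM2l//.
rewrite mulrBr mulr1 big_ltn// mul1r lerDl sumr_ge0// => k _.
by rewrite -{1}[p k]mulr1 -mulrBr mulr_ge0// subr_ge0 cos_le1.
Qed.

(** The terms k = 0, 1, 2 of a nonnegative series are kept, with 1 + cos (2 x) = 2 cos^2 x. This
    will keep phi above -1. *)
Lemma one_plus_cosine_series :
  2 * p 0 + 2 * p 1 * (1 + cos x) + 4 * p 2 * cos x ^+ 2 <= 1 + phi x.
Proof.
have H : (p 0 + 2 * \sum_(1 <= k < m.+1) p k) + (p 0 + 2 *
    \sum_(1 <= k < m.+1) p k * cos (k%:R * x)) @[m --> \oo] --> 1 + phi x.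
  exact: cvgD.
rewrite -(cvg_lim _ H)//.
apply: limr_ge; first exact: cvgP H.
exists 2%N => //= m /= m2.
rewrite addrACA -mulr2n -[p 0 *+ 2]mulr_natl -!addrA lerD2l -mulrDr -big_split/=.
rewrite big_ltn ?ltnS ?(ltnW m2)//.
rewrite big_ltn// mul1r !mulrDr addrA -[leLHS]addr0 lerD//.
  rewrite mulr_natl [2%:R * x]mulr_natl cos_mulr2n.
  by rewrite le_eqVlt; apply/orP; left; apply/eqP; ring.
rewrite mulr_ge0// sumr_ge0// => k _.
by rewrite -{1}[p k]mulr1 -mulrDr mulr_ge0// -lerBlDl sub0r cos_geN1.
Qed.

End cosine_series.

Section step_prob.
Context {R : realType}.
Variables (alpha mu : R).
Hypotheses (alpha_gt0 : 0 < alpha) (alpha_le2 : alpha <= 2) (alpha_neq1 : alpha <> 1).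
Hypothesis mu_gt0 : 0 < mu.
Local Notation c := (cos (alpha * pi / 2)).

Lemma cos_alpha_gt0 : alpha < 1 -> 0 < c.
Proof.
move=> a1; apply: cos_gt0_pihalf; have pi0 := @pi_gt0 R.
rewrite (lt_trans (_ : _ < 0)) ?oppr_lt0 ?divr_gt0 ?mulr_gt0//=.
by rewrite ltr_pM2r ?invr_gt0// gtr_pMl.
Qed.

Lemma alpha_gt1 : ~~ (alpha < 1) -> 1 < alpha.
Proof. by rewrite -leNgt le_eqVlt => /orP[/eqP/esym|]. Qed.

Lemma cos_alpha_lt0 : ~~ (alpha < 1) -> c < 0.
Proof.
move=> /alpha_gt1 a1; have pi0 := @pi_gt0 R.
rewrite (_ : alpha * pi / 2 = (alpha - 1) * pi / 2 + pi / 2); last by field.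
rewrite cosDpihalf oppr_lt0 sin_gt0_pi//.
have a1' : 0 < alpha - 1 by rewrite subr_gt0.
rewrite divr_gt0 ?mulr_gt0//=.
rewrite -mulrA (le_lt_trans (_ : _ <= 1 * (pi / 2)))//.
  by rewrite ler_wpM2r ?divr_ge0 ?(ltW pi0)// lerBlDr.
by rewrite mul1r ltr_pdivrMr// ltr_pMr// ltr1n.
Qed.

Lemma cos_alpha_neq0 : c != 0.
Proof.
have [/cos_alpha_gt0/lt0r_neq0//|a1] := boolP (alpha < 1).
by rewrite lt_eqF// cos_alpha_lt0.
Qed.

Lemma step_prob_sym (k : int) : step_prob alpha mu (- k) = step_prob alpha mu k.
Proof.
by rewrite /step_prob; case: ifP => _;
  rewrite /step_prob_lt1 /step_prob_gt1 oppr_eq0 !abszN.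
Qed.

Let shift : R := if alpha < 1 then 0 else 1.

(* This is the characteristic function of a step on [0, pi] only. *)
Definition step_char (x : R) := 1 - mu / c *
  ((2 * sin (x / 2)) `^ alpha * cos (shift * x + alpha * ((pi - x) / 2))).

Lemma measurable_step_char : measurable_fun [set: R] step_char.
Proof.
have msin : measurable_fun [set: R] (@sin R).
  by apply: continuous_measurable_fun; exact: continuous_sin.
have mcos : measurable_fun [set: R] (@cos R).
  by apply: continuous_measurable_fun; exact: continuous_cos.
apply: measurable_funB => //; apply: measurable_funM => //; apply: measurable_funM.
  apply: (measurableT_comp (measurable_powR alpha)); apply: measurable_funM => //.
  by apply: measurableT_comp => //; exact: measurable_funM.
apply: measurableT_comp => //; apply: measurable_funD; first exact: measurable_funM.
apply: measurable_funM => //; apply: measurable_funM => //.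
exact: measurable_funB.
Qed.

Lemma gbinom0 : gbinom alpha 0 = 1.
Proof. by rewrite /gbinom big_ord0 fact0 divr1. Qed.

Lemma gbinom1 : gbinom alpha 1 = alpha.
Proof. by rewrite /gbinom big_ord1 subr0 divr1. Qed.

Lemma step_prob_lt1E k : (0 < k)%N ->
  step_prob_lt1 alpha mu k%:Z = - (mu / (2 * c)) * ((-1) ^+ k * gbinom alpha k).
Proof.
by case: k => // k _; rewrite /step_prob_lt1 /= addn1 [(-1) ^+ k.+2]exprS; ring.
Qed.

Lemma step_prob_gt1E k : (1 < k)%N ->
  step_prob_gt1 alpha mu k%:Z = - (mu / (2 * c)) * ((-1) ^+ k.+1 * gbinom alpha k.+1).
Proof.
by case: k => [|[|k]]// _; rewrite /step_prob_gt1 /= addn1 [(-1) ^+ k.+3]exprS; ring.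
Qed.

(** Beyond the first indices the probabilities are, up to sign and the nonzero factor mu / (2 c),
    the binomials themselves (shifted by one in case (b)), so the decay of the law replaces an
    asymptotic estimate of binomials. *)
Lemma gbinom_cvg0 : (fun k : nat => step_prob alpha mu k%:Z) @ \oo --> 0 ->
  gbinom alpha @ \oo --> 0.
Proof.
move=> p0; have c0 := cos_alpha_neq0; have m0 := lt0r_neq0 mu_gt0.
apply/norm_cvg0P.
have : `|2 * c / mu| * `|step_prob alpha mu k%:Z| @[k --> \oo] --> 0.
  rewrite -[X in _ --> X](mulr0 (`|2 * c / mu|)) -(@normr0 _ R).
  by apply: cvgMr; exact: cvg_norm.
have N k (b : R) : `|2 * c / mu| * `|- (mu / (2 * c)) * ((-1) ^+ k * b)| = `|b| :> R.
  rewrite -normrM (_ : 2 * c / mu * _ = - ((-1) ^+ k * b)); last first.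
    by move: (cos _) c0 ((-1) ^+ k * b) => C C0 D; field; rewrite C0 m0.
  by rewrite normrN normrM normrX normrN1 expr1n mul1r.
rewrite /step_prob; case: ifPn => a1.
  apply: cvg_trans; apply: near_eq_cvg; exists 1%N => //= k /= k1.
  by rewrite step_prob_lt1E// N.
move=> H; rewrite -cvg_shiftS; apply: cvg_trans H; apply: near_eq_cvg.
exists 2%N => //= k /= k2.
by rewrite step_prob_gt1E// N.
Qed.

(** Case (a) is the real part of (1 - e^(ix))^alpha, phase 0. Case (b) is that of e^(-ix) (1 -
    e^(ix))^alpha, phase - x: index k + 1 then yields cos (k x), index 1 the constant term, and
    indices 0 and 2 both yield cos x, whence the factor 1 + binom(alpha, 2) in p_1. *)
Lemma step_char_cvg x : 0 < x <= pi -> gbinom alpha @ \oo --> 0 ->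
  step_prob alpha mu 0 + 2 * \sum_(1 <= k < m.+1) step_prob alpha mu k%:Z * cos (k%:R * x)
  @[m --> \oo] --> step_char x.
Proof.
move=> xpi b0; have c0 := cos_alpha_neq0.
pose B psi k := (-1) ^+ k * gbinom alpha k * cos (psi + k%:R * x).
have L psi : 1 - mu / c * \sum_(0 <= k < N.+1) B psi k
   @[N --> \oo] --> 1 - mu / c *
     ((2 * sin (x / 2)) `^ alpha * cos (psi - alpha * ((pi - x) / 2))).
  apply: cvgB; first exact: cvg_cst.
  by apply: cvgMr; exact: binomial_circle.
rewrite /step_char -[cos (_ + _)]cosN opprD /shift /step_prob; case: ifPn => a1.
  rewrite mul0r oppr0; apply: cvg_trans (L 0); apply: near_eq_cvg; apply: nearW => m.
  rewrite big_ltn// /B gbinom0 expr0 !mul1r mul0r addr0 cos0 mulrDr mulr1 opprD addrA.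
  congr (_ + _); rewrite !mulr_sumr -sumrN; apply: eq_big_nat => k /andP[k0 _].
  by rewrite step_prob_lt1E// add0r; field.
have L2 psi : 1 - mu / c * \sum_(0 <= k < N.+3) B psi k
   @[N --> \oo] --> 1 - mu / c *
     ((2 * sin (x / 2)) `^ alpha * cos (psi - alpha * ((pi - x) / 2))).
  rewrite (cvg_shiftS (fun N => 1 - mu / c * \sum_(0 <= k < N.+2) B psi k)).
  by rewrite (cvg_shiftS (fun N => 1 - mu / c * \sum_(0 <= k < N.+1) B psi k)).
rewrite mul1r -cvg_shiftS; apply: cvg_trans (L2 (- x)).
apply: near_eq_cvg; apply: nearW => m.
rewrite /= big_ltn// big_ltn// big_ltn// big_add1/= [in RHS]big_ltn//.
have E : 2 * \sum_(2 <= k < m.+2) step_prob_gt1 alpha mu k * cos (k%:R * x) =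
    - (mu / c * \sum_(2 <= k < m.+2) B (- x) k.+1).
  rewrite !mulr_sumr -sumrN; apply: eq_big_nat => k /andP[k0 _].
  rewrite step_prob_gt1E// /B -[k.+1%:R]natr1 (_ : - x + _ = k%:R * x); last by ring.
  by field.
rewrite [in RHS]mulrDr E /B gbinom0 gbinom1 /step_prob_gt1 /= gbinom1.
have -> : - x + 0%:R * x = - x by ring.
have -> : - x + 1%:R * x = 0 by ring.
have -> : - x + 2%:R * x = x by ring.
rewrite cosN cos0 !mul1r; move: (\sum_(2 <= k < m.+2) _) (cos _) c0 => S C C0.
by field; rewrite C0.
Qed.

Lemma chord_ratio_cvg1 : 2 * sin (x / 2) / x @[x --> (0:R)^'+] --> (1 : R).
Proof.
have dg : is_derive (0 : R) 1 (fun x : R => 2 * sin (x / 2)) 1.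
  have d2 := is_derive1M (is_derive_id (0 : R) 1) (is_derive1_const 2^-1 (0 : R)).
  have := is_derive1M (is_derive1_const 2 (0 : R))
    (@is_derive1_fun R (@sin R) _ (0 : R) _ _ (is_derive_sin _) d2).
  move=> H; apply: (is_derive_eq H).
  by rewrite !mul0r cos0 add0r addr0 !mul1r mulfV.
have [dg1 dgE] := dg.
have : h^-1 *: (2 * sin ((h *: 1 + 0) / 2) - 2 * sin (0 / 2)) @[h --> (0:R)^'] --> (1 : R).
  by rewrite -[X in _ --> X]dgE; exact: dg1.
move=> /cvg_dnbhs_at_right; apply: cvg_trans; apply: near_eq_cvg; apply: nearW => h.
by rewrite /GRing.scale /= addr0 mulr1 mul0r sin0 mulr0 subr0 mulrC.
Qed.

(** The chord 2 sin (x / 2) is equivalent to x, and the phase tends to alpha pi / 2, whose cosine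
    cancels the denominator [c]. *)
Lemma step_char_asymp : (1 - step_char x) / x `^ alpha @[x --> 0^'+] --> mu.
Proof.
have c0 := cos_alpha_neq0.
have H : mu / c *
    ((2 * sin (x / 2) / x) `^ alpha * cos (shift * x + alpha * ((pi - x) / 2)))
    @[x --> 0^'+] --> mu / c * ((1 : R) `^ alpha * c).
  apply: cvgMr; apply: cvgM.
    apply: (@cvg_comp _ _ _ (fun x => 2 * sin (x / 2) / x) (fun y => y `^ alpha)
      _ (nbhs (1 : R))).
      exact: chord_ratio_cvg1.
    have [d1 _] := is_derive1_powR alpha (@ltr01 R).
    have cp : {for 1, continuous (fun y : R => y `^ alpha)}.
      exact/differentiable_continuous/derivable1_diffP.
    exact: cp.
  apply: cvg_at_right_filter.
  rewrite (_ : c = cos (shift * 0 + alpha * ((pi - 0) / 2))); last by congr cos; ring.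
  apply: (@cvg_comp _ _ _ (fun x => shift * x + alpha * ((pi - x) / 2)) cos);
    last exact: continuous_cos.
  apply: cvgD; first by apply: cvgMr; exact: cvg_id.
  apply: cvgMr; apply: cvgMl; apply: cvgB; [exact: cvg_cst|exact: cvg_id].
rewrite powR1 mul1r divfK// in H; apply: cvg_trans H; apply: near_eq_cvg; near=> x.
have x0 : 0 < x by [].
have x1 : x < pi by near: x; apply: nbhs_right_lt; exact: pi_gt0.
have s0 : 0 <= 2 * sin (x / 2).
  rewrite mulr_ge0// ltW// sin_gt0_pi// divr_gt0//=.
  by rewrite ltr_pdivrMr// (lt_le_trans x1)// ler_peMr ?pi_ge0// ler1n.
have xV : x^-1 `^ alpha = (x `^ alpha)^-1.
  by rewrite -powR_inv1 ?(ltW x0)// -powRrM mulN1r powRN.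
rewrite /step_char subKr powRM ?invr_ge0 ?(ltW x0)// xV.
by rewrite -!mulrA; congr (_ * (_ * (_ * _))); rewrite mulrC.
Unshelve. all: by end_near. Qed.

End step_prob.

Section decay.
Context {R : realType}.

Lemma power_decay (phi : R -> R) (alpha mu M : R) : 0 < alpha -> 0 < mu -> 0 < M ->
  (1 - phi x) / x `^ alpha @[x --> 0^'+] --> mu ->
  (forall e, 0 < e -> exists2 eta, 0 < eta &
     forall x, e <= x <= M -> `|phi x| <= 1 - eta) ->
  exists2 c, 0 < c & forall x, 0 < x <= M -> `|phi x| <= expR (- c * x `^ alpha).
Proof.
move=> a0 mu0 M0 asym sep.
have [e e0 He] : exists2 e : R, 0 < e & forall x, 0 < x < e ->
    0 <= phi x <= 1 - mu / 2 * x `^ alpha.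
  have : \forall x \near 0^'+, 0 <= phi x <= 1 - mu / 2 * x `^ alpha.
    near=> x.
    have x0 : 0 < x by [].
    have xa0 : 0 < x `^ alpha by rewrite powR_gt0.
    have H1 : mu / 2 < (1 - phi x) / x `^ alpha.
      by near: x; apply: (cvgr_gt mu asym); rewrite ltr_pdivrMr// ltr_pMr// ltr1n.
    have H2 : (1 - phi x) / x `^ alpha < 2 * mu.
      by near: x; apply: (cvgr_lt mu asym); rewrite ltr_pMl// ltr1n.
    have H3 : x `^ alpha < (2 * mu)^-1.
      by near: x; apply: (cvgr_lt 0 (powR_cvg0 a0)); rewrite invr_gt0 mulr_gt0.
    rewrite ltr_pdivlMr// in H1; rewrite ltr_pdivrMr// in H2.
    rewrite -(ltr_pM2l (_ : 0 < 2 * mu)) ?mulr_gt0// mulfV ?gt_eqF ?mulr_gt0// in H3.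
    apply/andP; split; lra.
  move=> [e /= e0 He]; exists e => // x /andP[x0 xe]; apply: He => //=.
  by rewrite sub0r normrN gtr0_norm.
have [eta eta0 Heta] := sep e e0.
have Ma0 : 0 < M `^ alpha by rewrite powR_gt0.
(* The first constant serves x < e; the second makes c x^alpha <= eta on [e, M]. Both cases end with
   1 - v <= exp (- v). *)
exists (Num.min (mu / 2) (eta / M `^ alpha)).
  by rewrite lt_min !divr_gt0.
move=> x /andP[x0 xM]; have xa0 : 0 <= x `^ alpha by exact: powR_ge0.
rewrite (le_trans _ (expR_ge1Dx _))// mulNr.
have [ex|xe] := leP e x.
  rewrite (le_trans (Heta x _)) ?ex// lerD2l lerN2.
  rewrite (@le_trans _ _ (eta / M `^ alpha * M `^ alpha))//; last by rewrite divfK// gt_eqF.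
  rewrite ler_pM ?le_min ?divr_ge0 ?(ltW mu0) ?(ltW eta0) ?(ltW Ma0)// ?ge_min ?lexx ?orbT//.
  by rewrite ge0_ler_powR// ?nnegrE ltW.
have /andP[p0 p1] : 0 <= phi x <= 1 - mu / 2 * x `^ alpha by apply: He; rewrite x0.
rewrite ger0_norm// (le_trans p1)// lerD2l lerN2 ler_wpM2r// ge_min lexx.
by [].
Unshelve. all: by end_near.
Qed.

End decay.

Section period.
Context {R : realType}.
Variables (alpha mu : R).
Hypotheses (alpha_gt0 : 0 < alpha) (alpha_le2 : alpha <= 2) (alpha_neq1 : alpha <> 1).
Hypothesis mu_gt0 : 0 < mu.
Local Notation c := (cos (alpha * pi / 2)).
Local Notation p := (step_prob alpha mu).
Hypothesis p_ge0 : forall k, 0 <= p k.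

Lemma gbinom2 : 2 * gbinom alpha 2 = (alpha - 1) * alpha.
Proof. by rewrite gbinomS gbinom1. Qed.

Lemma gbinom3 : 6 * gbinom alpha 3 = (alpha - 2) * (alpha - 1) * alpha.
Proof.
transitivity (2 * (3%:R * gbinom alpha 3)); first by ring.
by rewrite gbinomS mulrCA gbinom2 mulrA.
Qed.

Lemma step_prob1_gt0 : 0 < p 1.
Proof.
rewrite /step_prob; case: ifPn => a1.
  rewrite step_prob_lt1E// gbinom1 expr1 mulN1r mulrNN mulr_gt0//.
  by rewrite divr_gt0// mulr_gt0// cos_alpha_gt0.
have a1' : 1 < alpha by exact: alpha_gt1.
rewrite /step_prob_gt1 /= mulr_gt0//.
  by rewrite oppr_gt0 pmulr_rlt0// invr_lt0 pmulr_rlt0// cos_alpha_lt0.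
have := gbinom2; have : 0 < (alpha - 1) * alpha by rewrite mulr_gt0// subr_gt0.
lra.
Qed.

Lemma step_prob2_gt0 : alpha < 2 -> 0 < p 2.
Proof.
move=> a2; rewrite /step_prob; case: ifPn => a1.
  rewrite step_prob_lt1E// sqrrN expr1n mul1r mulNr -mulrN mulr_gt0//.
    by rewrite divr_gt0// mulr_gt0// cos_alpha_gt0.
  have := gbinom2; have : 0 < (1 - alpha) * alpha by rewrite mulr_gt0// subr_gt0.
  lra.
have a1' : 1 < alpha by exact: alpha_gt1.
rewrite step_prob_gt1E// (_ : _ * (_ * _) = (mu / (2 * - c)) * (- gbinom alpha 3)); last first.
  have c0 := cos_alpha_neq0 alpha_gt0 alpha_le2 alpha_neq1.
  by move: (cos _) c0 => C C0; field; rewrite ?oppr_eq0 C0.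
rewrite mulr_gt0//.
  by rewrite divr_gt0// mulr_gt0// oppr_gt0 cos_alpha_lt0.
have := gbinom3.
have : 0 < (2 - alpha) * (alpha - 1) * alpha by rewrite !mulr_gt0// subr_gt0.
lra.
Qed.

(* The walk is aperiodic unless it is the simple random walk. *)
Lemma step_prob_period : exists s : nat, [/\ (0 < s)%N,
  forall k : int, p k != 0 -> (s%:Z %| k - 1)%Z &
  s = 1%N /\ 0 < p 0 + p 2 \/ s = 2%N].
Proof.
have aper : 0 < p 0 + p 2 -> exists s : nat, [/\ (0 < s)%N,
    forall k : int, p k != 0 -> (s%:Z %| k - 1)%Z &
    s = 1%N /\ 0 < p 0 + p 2 \/ s = 2%N].
  by move=> p02; exists 1%N; split => //; left.
have [a2|a2] := ltP alpha 2.
  by apply: aper; rewrite ltr_wpDl// step_prob2_gt0.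
have alpha2 : alpha = 2 by apply/eqP; rewrite eq_le alpha_le2.
(* At alpha = 2 the steps reduce to 0 and +-1, because binom(2, k) = 0 for k >= 3. If moreover p 0 =
   0, then k - 1 is 0 or -2, and s = 2. *)
have [p0|p0] := eqVneq (p 0) 0; last first.
  by apply: aper; rewrite ltr_pwDl// lt_neqAle eq_sym p0 p_ge0.
exists 2%N; split => //; last by right.
have a1 : (alpha < 1) = false by rewrite alpha2 ltNge ler1n.
have b0 n : gbinom (2:R) n.+3 = 0.
  rewrite /gbinom (bigD1 (@Ordinal n.+3 2 isT))//= subrr !mul0r.
  by [].
case=> [[|[|n]]|[|n]] // pk0.
- by move: pk0; rewrite p0 eqxx.
- by move: pk0; rewrite /step_prob a1 step_prob_gt1E// alpha2 b0 !mulr0 eqxx.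
- move: pk0; rewrite NegzE step_prob_sym /step_prob a1 step_prob_gt1E//.
  by rewrite alpha2 b0 !mulr0 eqxx.
Qed.

Hypothesis p_sum : p 0 + 2 * \sum_(1 <= k < m.+1) p k%:Z @[m --> \oo] --> (1 : R).

Lemma step_prob_gbinom_cvg0 : gbinom alpha @ \oo --> 0.
Proof.
apply: (@gbinom_cvg0 _ _ mu) => //.
exact: (@summand_cvg0 _ (fun k : nat => p k%:Z) p_sum).
Qed.

Lemma step_char_decay (s : nat) : (0 < s)%N -> s = 1%N /\ 0 < p 0 + p 2 \/ s = 2%N ->
  exists2 c, 0 < c & forall x, 0 < x <= pi / s%:R ->
    `|step_char alpha mu x| <= expR (- c * x `^ alpha).
Proof.
move=> s0 sP; have pi0 := @pi_gt0 R; have p1 := step_prob1_gt0.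
have Mpi : pi / s%:R <= pi :> R by rewrite ler_pdivrMr ?ltr0n// ler_peMr ?ler1n// ltW.
apply: (@power_decay _ _ _ mu) => //; first by rewrite divr_gt0// ltr0n.
  exact: step_char_asymp.
(* For e > pi the range [e, pi / s] is empty; otherwise e lies where the cosine decreases, which is
   used in [H3]. *)
move=> e e0; have [pie|epi] := ltP pi e.
  exists 1 => // x /andP[ex xs].
  by have := lt_le_trans pie (le_trans ex (le_trans xs Mpi)); rewrite ltxx.
have [eta eta0 Heta] : exists2 eta, 0 < eta &
    forall x, 0 < x <= pi / s%:R -> eta <= 1 + step_char alpha mu x.
  have lb x : 0 < x <= pi / s%:R -> 2 * p 0 + 2 * p 1 * (1 + cos x) +
      4 * p 2 * cos x ^+ 2 <= 1 + step_char alpha mu x.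
    move=> /andP[x0 xs]; apply: (@one_plus_cosine_series _ (fun k : nat => p k%:Z)) => //.
    apply: step_char_cvg => //; last exact: step_prob_gbinom_cvg0.
    by rewrite x0 (le_trans xs).
  have p00 := p_ge0 0; have p20 := p_ge0 2.
  case: sP => [[_ p02]|s2].
    (* Either cos x >= - 1/2 and the term in p 1 is at least p 1, or cos^2 x > 1/4 and the two other
       terms add up to at least p 0 + p 2. *)
    exists (Num.min (p 1) (p 0 + p 2)); first by rewrite lt_min p1.
    move=> x /lb; apply: le_trans; rewrite ge_min.
    have cx := cos_geN1 x; have [cx2|cx2] := leP (- (1 / 2)) (cos x).
      apply/orP; left; have : 0 <= p 2 * cos x ^+ 2 by rewrite mulr_ge0// sqr_ge0.
      have : 0 <= p 1 * (cos x + 1 / 2) by rewrite mulr_ge0 ?(ltW p1)// -lerBlDr sub0r.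
      lra.
    apply/orP; right; have : 0 <= p 2 * (cos x ^+ 2 - 1 / 4).
      rewrite mulr_ge0// subr_ge0.
      have : 0 < (- cos x - 1/2) * (- cos x + 1/2) by rewrite mulr_gt0; lra.
      lra.
    have : 0 <= p 1 * (1 + cos x) by rewrite mulr_ge0 ?(ltW p1)// -lerBlDl sub0r.
    lra.
  (* Here x <= pi / 2, so cos x >= 0 and the term in p 1 suffices; the cut excludes pi, where a walk
     with odd steps has characteristic function -1. *)
  exists (p 1) => // x xs; rewrite (le_trans _ (lb x xs))//.
  have : 0 <= cos x.
    apply: cos_ge0_pihalf; move: xs; rewrite s2 => /andP[x0 ->]; rewrite andbT.
    by rewrite (le_trans _ (ltW x0))// oppr_le0 divr_ge0// ltW.
  move=> cx; have : 0 <= p 1 * cos x by rewrite mulr_ge0// ltW.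
  have : 0 <= p 2 * cos x ^+ 2 by rewrite mulr_ge0// sqr_ge0.
  lra.
exists (Num.min (2 * p 1 * (1 - cos e)) eta).
  by rewrite lt_min eta0 andbT mulr_gt0 ?mulr_gt0// subr_gt0 cos_lt1// e0.
move=> x /andP[ex xs]; have x0 := lt_le_trans e0 ex.
have xpi := le_trans xs Mpi.
have H1 := Heta x; rewrite x0 xs in H1; have {}H1 := H1 isT.
have H2 : 2 * p 1 * (1 - cos x) <= 1 - step_char alpha mu x.
  apply: (@one_minus_cosine_series _ (fun k : nat => p k%:Z)) => //.
  by apply: step_char_cvg => //; [rewrite x0|exact: step_prob_gbinom_cvg0].
have H3 : cos x <= cos e.
  rewrite leNgt ltr_cos ?in_itv/= ?(ltW x0) ?(ltW e0)//.
  by rewrite -leNgt.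
have H4 : 0 <= p 1 * (cos e - cos x) by rewrite mulr_ge0 ?(ltW p1)// subr_ge0.
have M1 : Num.min (2 * p 1 * (1 - cos e)) eta <= 2 * p 1 * (1 - cos e) by rewrite ge_min lexx.
have M2 : Num.min (2 * p 1 * (1 - cos e)) eta <= eta by rewrite ge_min lexx orbT.
rewrite ler_norml; apply/andP; split; lra.
Qed.

End period.

(** * From the local limit theorem to distribution functions *)

Section fatou_lower_bound.
Context d (T : measurableType d) (R : realType) (m : {measure set T -> \bar R}).

(** The lower limit of the integrals is a supremum of infima over tails; a tail whose infimum
    exceeds G - e provides the rank. The sequence [u] only has to dominate the integrals, as it will
    be a probability. *)
Lemma fatou_near (A : set T) (f_ : nat -> T -> R) (g : T -> R) (G : R) (u : nat -> R) :
  measurable A -> (forall n, measurable_fun A (f_ n)) ->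
  (forall n y, A y -> 0 <= f_ n y) -> (forall y, A y -> f_ n y @[n --> \oo] --> g y) ->
  (\int[m]_(y in A) (g y)%:E)%E = G%:E ->
  (forall n, (\int[m]_(y in A) (f_ n y)%:E <= (u n)%:E)%E) ->
  forall e, 0 < e -> \forall n \near \oo, G - e < u n.
Proof.
move=> mA mf f0 fg gG fu e e0.
have := fatou m mA (f := fun n y => (f_ n y)%:E).
move=> /(_ (fun n => (measurable_EFinP _ _).2 (mf n))).
have f0' n y : A y -> (0 <= (f_ n y)%:E)%E by move=> Ay; rewrite lee_fin f0.
move=> /(_ f0').
rewrite (_ : (\int[m]_(x in A) limn_einf _)%E = G%:E); last first.
  rewrite -gG; apply: eq_integral => y; rewrite inE => Ay.
  have := cvg_EFin; have H : (f_ n y)%:E @[n --> \oo] --> (g y)%:E.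
    by apply: cvg_EFin; [exact: nearW|exact: fg].
  by move=> _; exact: (cvg_limn_einf_sup H).1.
rewrite limn_einf_lim (cvg_lim _ (@cvg_einfs_sup _ _))//.
move=> GS.
have : ((G - e)%:E <
    ereal_sup (range (einfs (fun n => \int[m]_(x in A) (f_ n x)%:E))))%E.
  by apply: lt_le_trans GS; rewrite lte_fin ltrBlDr ltrDl.
move=> /ereal_sup_gt[_ [N _ <-]] GN; exists N => // n /= Nn.
rewrite -lte_fin (lt_le_trans GN)// (le_trans _ (fu n))//.
by apply: ereal_inf_lbound; exists n.
Qed.

End fatou_lower_bound.

Section lattice_rounding.
Context {R : realType}.
Local Notation leb := (@lebesgue_measure R).

Lemma measurable_floor_int (f : R -> R) : measurable_fun [set: R] f ->
  measurable_fun [set: R] (fun y => Num.floor (f y) : int).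
Proof.
move=> mf _ B _; rewrite setTI.
have -> : (fun y => Num.floor (f y) : int) @^-1` B =
    \bigcup_(q in B) (f @^-1` `[q%:~R, (q + 1)%:~R[%classic).
  apply/seteqP; split=> y.
    by move=> By; exists (Num.floor (f y)) => //=; rewrite in_itv/=; exact: floor_itv.
  by move=> [q Bq] /=; rewrite in_itv/= => /floor_def ->.
rewrite bigcup_mkcond; apply: countable_bigcupT_measurable => [|q]; first exact: countableP.
case: ifP => _ //; rewrite -[X in measurable X]setTI; exact: mf.
Qed.

(* For [sg = 1] (resp. [-1]), [h * lattice_round sg s n h y] is the greatest
   element of [h * (n + s Z)] below [y] (resp. the least one above [y]). *)
Definition lattice_round (sg : int) (s n : nat) (h y : R) : int :=
  n%:Z + sg * s%:Z * Num.floor (sg%:~R * (y / h - n%:R) / s%:R).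

Variables (sg : int) (s n : nat) (h : R).
Hypotheses (sg1 : sg = 1 \/ sg = -1) (s_gt0 : (0 < s)%N) (h_gt0 : 0 < h).

Lemma measurable_lattice_round : measurable_fun [set: R] (lattice_round sg s n h).
Proof.
have mfl : measurable_fun [set: R]
    (fun y => Num.floor (sg%:~R * (y / h - n%:R) / s%:R) : int).
  apply: measurable_floor_int; apply: measurable_funM => //; apply: measurable_funM => //.
  by apply: measurable_funB => //; exact: measurable_funM.
by move=> _ B mB; rewrite setTI; have := mfl measurableT
  [set q | B (n%:Z + sg * s%:Z * q)] I; rewrite setTI.
Qed.

Lemma dvdz_lattice_round y : (s%:Z %| lattice_round sg s n h y - n%:Z)%Z.
Proof. by rewrite /lattice_round addrAC subrr add0r mulrAC dvdz_mull. Qed.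

Lemma lattice_round_itv y :
  0 <= sg%:~R * (y - h * (lattice_round sg s n h y)%:~R) < s%:R * h.
Proof.
set z := sg%:~R * (y / h - n%:R) / s%:R.
have s0 : 0 < s%:R :> R by rewrite ltr0n.
have sgsg : sg%:~R * sg%:~R = 1 :> R by case: sg1 => ->; rewrite ?mulr1 ?mulrNN ?mulr1.
have -> : sg%:~R * (y - h * (lattice_round sg s n h y)%:~R) =
    s%:R * h * (z - (Num.floor z)%:~R).
  rewrite /lattice_round -/z intrD !intrM -!pmulrn.
  have zE : s%:R * h * z = sg%:~R * (y - h * n%:R).
    by rewrite /z; field; rewrite (gt_eqF h_gt0) (gt_eqF s0).
  rewrite [in RHS]mulrBr zE; transitivity (sg%:~R * (y - h * n%:R) -
      (sg%:~R * sg%:~R) * (s%:R * h * (Num.floor z)%:~R)); first by ring.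
  by rewrite sgsg mul1r.
have /andP[z0 z1] := floor_itv z.
apply/andP; split; first by rewrite mulr_ge0 ?mulr_ge0 ?(ltW s0) ?(ltW h_gt0)// subr_ge0.
by rewrite gtr_pMr ?mulr_gt0// ltrBlDl -(intrD _ _ 1).
Qed.

Lemma lattice_round_dist y : `|h * (lattice_round sg s n h y)%:~R - y| <= s%:R * h.
Proof.
have /andP[r0 r1] := lattice_round_itv y; rewrite distrC.
rewrite (_ : `|_| = `|sg%:~R * (y - h * (lattice_round sg s n h y)%:~R)|).
  by rewrite ger0_norm// ltW.
by rewrite normrM; case: sg1 => ->; rewrite ?normrN normr1 mul1r.
Qed.

(** The cell of k lies to the right of h k for sg = 1 and to its left for sg = -1; a closed interval
    of length s h contains it either way. *)
Lemma lattice_round_level k :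
  (leb (lattice_round sg s n h @^-1` [set k]) <= (s%:R * h)%:E)%E.
Proof.
have sh0 : 0 < s%:R * h by rewrite mulr_gt0// ltr0n.
pose a := if sg == 1 then h * k%:~R else h * k%:~R - s%:R * h.
have H : leb `[a, a + s%:R * h] = (s%:R * h)%:E.
  by rewrite /= lebesgue_measure_itv/= lte_fin ltrDl sh0 -EFinD addrAC subrr add0r.
rewrite -H; apply: le_measure; rewrite ?inE//.
  by rewrite -[X in measurable X]setTI; exact: measurable_lattice_round.
move=> y /= yk; have := lattice_round_itv y; rewrite yk in_itv/= /a.
case: sg1 => ->; rewrite ?eqxx/= ?mul1r ?mulN1r => /andP[l1 l2]; apply/andP; split; lra.
Qed.

End lattice_rounding.

Section lattice_density.
Context d (T : measurableType d) (R : realType) (P : probability T R).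
Local Notation leb := (@lebesgue_measure R).

(* The integrand spreads the mass of each integer [k] over the level set
   [r = k]. *)
Lemma integral_lattice_density_le (N : T -> int) (r : R -> int) (A : set R)
    (B : set int) (L : R) :
  (forall k, measurable [set w | N w = k]) -> measurable_fun [set: R] r ->
  measurable A -> (forall y, A y -> B (r y)) -> 0 < L ->
  (forall k, (leb (r @^-1` [set k]) <= L%:E)%E) ->
  (\int[leb]_(y in A) (L^-1 * fine (P [set w | N w = r y]))%:E <= P [set w | B (N w)])%E.
Proof.
move=> mN mr mA AB L0 rL.
have mr1 k : measurable (r @^-1` [set k]) by rewrite -[X in measurable X]setTI; exact: mr.
have mNB : measurable [set w | B (N w)] by exact: measurable_preim_of_points.
(* Tonelli for the indicator of [C]: integrating over T first gives P(N = r y), for y in A;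
   integrating over R first gives the length of the part of A in the cell of N w, which is at most L
   and is 0 unless B (N w). *)
pose C : set (T * R) := [set z | A z.2 /\ N z.1 = r z.2].
have mC : measurable C.
  rewrite (_ : C = \bigcup_k ([set w | N w = k] `*` (A `&` r @^-1` [set k]))).
    apply: countable_bigcupT_measurable => [|k]; first exact: countableP.
    by apply: measurableX => //; exact: measurableI.
  apply/seteqP; split=> [[w y] [/= Ay Nr]|[w y] [k _ [/= Nk [Ay /= rk]]]].
    by exists (r y) => //; split.
  by split => //=; rewrite Nk rk.
have mf : measurable_fun [set: T * R] (fun z => (\1_C z)%:E : \bar R).
  by apply/measurable_EFinP; exact: measurable_indic.
have f0 z : (0 <= (\1_C z)%:E :> \bar R)%E by rewrite lee_fin.
have := @fubini_tonelli _ _ _ _ R P leb (fun z => (\1_C z)%:E) mf f0.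
rewrite /fubini_F /fubini_G.
rewrite (_ : (\int[leb]_y _)%E = (\int[leb]_(y in A) P [set w | N w = r y])%E); last first.
  rewrite [RHS]integral_mkcond; apply: eq_integral => y _ /=.
  rewrite patchE; case: ifPn => [|]; rewrite ?inE ?notin_setE => Ay.
    rewrite -[in RHS](setIT [set w | N w = r y]) -integral_indic//.
    apply: eq_integral => w _; congr (_%:E); rewrite !indicE; congr (nat_of_bool _)%:R.
    by apply/idP/idP; rewrite !inE; [case|split].
  rewrite integral0_eq// => w _; rewrite indicE memNset//.
  by move=> [].
move=> E.
have mP : measurable_fun A (fun y => P [set w | N w = r y]).
  apply: measurable_funTS.
  have mg : measurable_fun [set: int] (fun k => P [set w | N w = k]) by [].
  exact: (measurableT_comp mg mr).
rewrite (_ : (\int[leb]_(y in A) _)%E =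
    (\int[leb]_(y in A) ((L^-1)%:E * P [set w | N w = r y]))%E); last first.
  by apply: eq_integral => y _; rewrite EFinM fineK// fin_num_measure.
rewrite ge0_integralZl_EFin//; last by rewrite invr_ge0 ltW.
rewrite -E lee_pdivrMl//.
rewrite -[X in P X]setIT -integral_indic//.
rewrite -ge0_integralZl_EFin//; last 2 first.
- by apply/measurable_EFinP; exact: measurable_indic.
- exact: ltW.
apply: ge0_le_integral => //.
- by move=> w _; apply: integral_ge0.
- exact: (@indic_measurable_fun_fubini_tonelli_F _ _ _ _ _ leb _ mC).
- by apply: measurable_funeM; apply/measurable_EFinP; exact: measurable_indic.
move=> w _.
rewrite (_ : (\int[leb]_y _)%E = leb (A `&` r @^-1` [set N w])); last first.
  rewrite -[in RHS](setIT (A `&` _)) -integral_indic//; last first.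
    by apply: measurableI => //; exact: mr1.
  apply: eq_integral => y _; congr (_%:E); rewrite !indicE; congr (nat_of_bool _)%:R.
  by apply/idP/idP; rewrite !inE; case=> /= Ay Nr; split.
have [Bw|Bw] := pselect (B (N w)).
  rewrite indicE mem_set// mule1 (le_trans _ (rL (N w)))//.
  apply: le_measure; rewrite ?inE; [|exact: mr1|exact: subIsetr].
  by apply: measurableI => //; exact: mr1.
rewrite (_ : A `&` _ = set0) ?measure0; last first.
  by apply/seteqP; split=> // y [Ay /= ry]; apply: Bw; rewrite -ry; exact: AB.
by rewrite mule_ge0// lee_fin ltW.
Qed.

End lattice_density.

Theorem theorem4p2 (R : realType) (alpha mu t : R)
  (d : measure_display) (T : measurableType d) (P : probability T R)
  (Y : nat -> {RV P >-> int})
  (h : nat -> R)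
  (d' : measure_display) (T' : measurableType d') (Q : probability T' R)
  (S : {RV Q >-> R})
  (alpha_gt0 : 0 < alpha) (alpha_le2 : alpha <= 2) (alpha_neq1 : alpha <> 1)
  (mu_gt0 : 0 < mu)
  (mu_le_a : alpha < 1 -> mu <= cos (alpha * pi / 2))
  (mu_le_b : 1 < alpha -> mu <= `|cos (alpha * pi / 2)| / alpha)
  (Y_indep : mutually_independent Y)
  (Y_law : forall (m : nat) (k : int),
     P [set w | Y m w = k] = (step_prob alpha mu k)%:E)
  (t_gt0 : 0 < t)
  (h_gt0 : forall n : nat, (0 < n)%N -> 0 < h n)
  (h_scaling : forall n : nat, (0 < n)%N -> t / n%:R = mu * h n `^ alpha)
  (S_density : has_density S (stable_density alpha t)) :
  cvg_in_distribution (fun n : nat => scaled_walk h Y n : {RV P >-> R}) S.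
Proof.
move=> x _; have [mg g_ge0 gE] := S_density.
set p := step_prob alpha mu; set phi := step_char alpha mu.
(* Nonnegativity and, below, total mass one are read off from the law of the steps instead of from
   signs and sums of binomials. *)
have p_ge0 k : 0 <= p k := law_ge0 Y_law k.
have p_sym k : p (- k) = p k := step_prob_sym alpha mu k.
have p_sum : p 0 + 2 * \sum_(1 <= k < m.+1) p k%:Z @[m --> \oo] --> (1 : R).
  exact: (law_sum_cvg1 Y_law p_sym).
have [s [s_gt0 p_span sP]] := step_prob_period alpha_gt0 alpha_le2 alpha_neq1 mu_gt0 p_ge0.
have [c c_gt0 phi_le] := step_char_decay alpha_gt0 alpha_le2 alpha_neq1 mu_gt0
  p_ge0 p_sum s_gt0 sP.
have phi_meas : measurable_fun [set: R] phi by exact: measurable_step_char.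
have phi_cvg y : 0 < y <= pi -> p 0 + 2 * \sum_(1 <= k < m.+1) p k%:Z * cos (k%:R * y)
    @[m --> \oo] --> phi y.
  move=> ypi; apply: step_char_cvg => //.
  exact: (step_prob_gbinom_cvg0 alpha_gt0 alpha_le2 alpha_neq1 mu_gt0 p_sum).
have phi_asymp := @step_char_asymp R alpha mu alpha_gt0 alpha_le2 alpha_neq1.
pose N n w : int := \sum_(m < n) Y m w.
have mN n (B : set int) : measurable [set w | B (N n w)] := measurable_walk Y n B.
have mN1 n k : measurable [set w | N n w = k] := mN n [set k].
have s0 : 0 < s%:R :> R by rewrite ltr0n.
pose r sg n := lattice_round sg s n.+1 (h n.+1).
pose L n := s%:R * h n.+1.
have L0 n : 0 < L n by rewrite mulr_gt0// h_gt0.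
pose f sg n y := (L n)^-1 * fine (P [set w | N n.+1 w = r sg n y]).
have f_ge0 sg n y : 0 <= f sg n y by rewrite mulr_ge0 ?invr_ge0 ?(ltW (L0 n))// fine_ge0.
have mf sg n : measurable_fun [set: R] (f sg n).
  apply: measurable_funM => //.
  have mk : measurable_fun [set: int] (fun k => fine (P [set w | N n.+1 w = k])) by [].
  exact: (measurableT_comp mk (measurable_lattice_round _ _ _ _)).
have f_cvg sg y : sg = 1 \/ sg = -1 -> f sg n y @[n --> \oo] --> stable_density alpha t y.
  move=> sg1.
  have H : h n * (lattice_round sg s n (h n) y)%:~R @[n --> \oo] --> y.
    apply/cvgrPdist_le => e e0; near=> n.
    have n0 : (0 < n)%N by near: n; exact: nbhs_infty_gt.
    rewrite distrC (le_trans (lattice_round_dist _ sg1 s_gt0 (h_gt0 n n0) y))//.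
    rewrite mulrC -ler_pdivlMr// ltW//; near: n.
    by apply: (scaling_near_lt alpha_gt0 mu_gt0 h_gt0 h_scaling); rewrite divr_gt0.
  have := local_limit alpha_gt0 mu_gt0 t_gt0 c_gt0 s_gt0 phi_meas phi_le phi_asymp
    h_gt0 h_scaling H.
  apply: cvg_trans; apply: near_eq_cvg; apply: nearW => n.
  rewrite /f; congr (_ * _); symmetry; apply: (walk_inversion Y_indep Y_law) => //.
    exact: h_gt0.
  exact: dvdz_lattice_round.
pose G := fine (cdf S x).
have GE : (\int[lebesgue_measure]_(y in `]-oo, x]) (stable_density alpha t y)%:E)%E = G%:E.
  by rewrite -gE// /G /cdf fineK// fin_num_measure.
(* Total mass one of the limit enters here and prevents mass from escaping to infinity. *)
have GE' : (\int[lebesgue_measure]_(y in `]x, +oo[) (stable_density alpha t y)%:E)%E =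
    (1 - G)%:E.
  rewrite -gE// -setCitvl probability_setC// EFinB; congr (1 - _)%E.
  by rewrite /G /cdf fineK// fin_num_measure.
pose a n := fine (P [set w | h n.+1 * (N n.+1 w)%:~R <= x]).
have mle n : measurable [set w | h n.+1 * (N n.+1 w)%:~R <= x].
  exact: (mN n.+1 [set k | h n.+1 * k%:~R <= x]).
have aE n : (a n)%:E = P [set w | h n.+1 * (N n.+1 w)%:~R <= x].
  by rewrite /a fineK// fin_num_measure.
(* With sg = 1 a point y <= x is rounded down to an atom that is also <= x. *)
have lo : forall e, 0 < e -> \forall n \near \oo, G - e < a n.
  apply: (@fatou_near _ _ R lebesgue_measure `]-oo, x]%classic (f 1)
    (stable_density alpha t) G a) => //.
  - by move=> n; apply: measurable_funTS; exact: mf.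
  - by move=> y _; apply: f_cvg; left.
  move=> n; rewrite aE.
  apply: (@integral_lattice_density_le _ _ _ P (N n.+1) (r 1 n) `]-oo, x]
    [set k | h n.+1 * k%:~R <= x]) => //.
  - exact: measurable_lattice_round.
  - move=> y /=; rewrite in_itv/= => yx.
    have := lattice_round_itv n.+1 (or_introl (erefl (1 : int))) s_gt0 (h_gt0 _ (ltn0Sn n)) y.
    rewrite mul1r => /andP[+ _]; rewrite subr_ge0 => /le_trans; exact.
  - by move=> k; apply: lattice_round_level => //; [left|exact: h_gt0].
(* With sg = -1 a point y > x is rounded up, so its atom also exceeds x; the bound obtained is an
   upper bound on [a n]. *)
have hi : forall e, 0 < e -> \forall n \near \oo, 1 - G - e < 1 - a n.
  apply: (@fatou_near _ _ R lebesgue_measure `]x, +oo[%classic (f (-1))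
    (stable_density alpha t) (1 - G) (fun n => 1 - a n)) => //.
  - by move=> n; apply: measurable_funTS; exact: mf.
  - by move=> y _; apply: f_cvg; right.
  move=> n.
  have -> : (1 - a n)%:E = P [set w | x < h n.+1 * (N n.+1 w)%:~R].
    rewrite EFinB aE -probability_setC//; congr (P _); apply/seteqP.
    by split=> w /=; rewrite ltNge => /negP.
  apply: (@integral_lattice_density_le _ _ _ P (N n.+1) (r (-1) n) `]x, +oo[
    [set k | x < h n.+1 * k%:~R]) => //.
  - exact: measurable_lattice_round.
  - move=> y /=; rewrite in_itv/= andbT => xy.
    have := lattice_round_itv n.+1 (or_intror (erefl (-1 : int))) s_gt0 (h_gt0 _ (ltn0Sn n)) y.
    rewrite mulN1r => /andP[+ _]; rewrite oppr_ge0 subr_le0 => /(lt_le_trans xy); exact.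
  - by move=> k; apply: lattice_round_level => //; [right|exact: h_gt0].
have -> : cdf S x = G%:E by rewrite /G /cdf fineK// fin_num_measure.
have cdfE n : (a n)%:E = cdf (scaled_walk h Y n.+1 : {RV P >-> R}) x.
  rewrite aE /cdf /distribution /pushforward; congr (P _); apply/seteqP.
  by split=> w /=; rewrite in_itv/= /scaled_walk /N rmorph_sum.
suff aG : a @ \oo --> G.
  rewrite -(cvg_shiftS (fun n => cdf (scaled_walk h Y n : {RV P >-> R}) x)).
  have : (a n)%:E @[n --> \oo] --> G%:E by apply: cvg_EFin; [exact: nearW|exact: aG].
  by apply: cvg_trans; apply: near_eq_cvg; apply: nearW => n; exact: cdfE.
apply/cvgrPdist_lt => e e0; near=> n.
have H1 : G - e < a n by near: n; exact: lo.
have H2 : 1 - G - e < 1 - a n by near: n; exact: hi.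
rewrite ltr_norml; apply/andP; split; lra.
Unshelve. all: by end_near. Qed.
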